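(* Let $B_I,B_{II},B_{IV},B_V,B_{VI_h}$ ($h\le0$), $B_{VII_h}$ ($h\ge0$) denote the $\mathrm{GL}_3(\mathbb{R})$-orbits, in the space $W=\Lambda^2(\mathbb{R}^3)^*\otimes\mathbb{R}^3$, of the Lie brackets on $\mathbb{R}^3$ specified in the context. Let $X\subseteq W$ be the closed subvariety of all Lie brackets on $\mathbb{R}^3$. With respect to the usual topology: \begin{itemize} \item the orbits contained in the closure of $B_V$ are exactly $B_V$ and $B_I$; \item the orbits contained in the closure of $B_{IV}$ are exactly $B_{IV},B_{II},B_V,B_I$; \item for each $h<0$, the orbits contained in the closure of $B_{VI_h}$ are exactly $B_{VI_h},B_{II},B_I$; the closure of $\bigcup_{h<0}B_{VI_h}$ contains in addition $B_{IV}$, $B_V$ and $B_{VI_0}$; \item for each $h>0$, the orbits contained in the closure of $B_{VII_h}$ are exactly $B_{VII_h},B_{II},B_I$; the union $\bigcup_{h>0}B_{VII_h}$ is $6$-dimensional, and its closure contains in addition $B_{IV}$, $B_V$ and $B_{VII_0}$. \end{itemize} (Here ''orbits'' means $\mathrm{GL}_3(\mathbb{R})$-orbits in $X$.)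
   Context: Elements of $W$ are identified with skew-symmetric bilinear maps $C:\mathbb{R}^3\times\mathbb{R}^3\to\mathbb{R}^3$. The group $\mathrm{GL}_3(\mathbb{R})$ acts by $(g.C)(a,b)=g\,C(g^{-1}a,g^{-1}b)$, and $X$ is the set of those $C$ satisfying the Jacobi identity. The orbits are those of the following brackets on the canonical basis $(e_1,e_2,e_3)$, all with $[e_1,e_2]=0$: \begin{itemize} \item $I$: $[e_2,e_3]=[e_3,e_1]=0$; \item $II$: $[e_2,e_3]=e_1$, $[e_3,e_1]=0$; \item $IV$: $[e_2,e_3]=e_1-e_2$, $[e_3,e_1]=e_1$; \item $V$: $[e_2,e_3]=-e_2$, $[e_3,e_1]=e_1$; \item $VI_h$ ($h\le 0$): $[e_2,e_3]=e_1-he_2$, $[e_3,e_1]=he_1-e_2$; \item $VII_h$ ($h\ge 0$): $[e_2,e_3]=e_1-he_2$, $[e_3,e_1]=he_1+e_2$. \end{itemize} The dimension of the union of orbits is its dimension as a real semialgebraic set. *)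

(* Defs.v *)
From mathcomp Require Import all_boot all_order all_algebra.
From mathcomp Require Import ring_quotient.
From mathcomp Require Import all_classical all_reals all_analysis.
From mathcomp Require Import ring.
(* The notations of [mpoly] clash with those of mathcomp-analysis. *)
From mathcomp Require Import (canonicals, coercions) mpoly.

Set Implicit Arguments.
Unset Strict Implicit.
Unset Printing Implicit Defensive.

Import Order.TTheory GRing.Theory Num.Theory.
Import numFieldNormedType.Exports.

Local Open Scope classical_set_scope.
Local Open Scope ring_scope.

Section Brackets.
Variable R : realType.

Definition e1 : 'cV[R]_3 := delta_mx 0 0.
Definition e2 : 'cV[R]_3 := delta_mx 1 0.
Definition e3 : 'cV[R]_3 := delta_mx 2 0.

(* 'M[R]_3 plays the role of W = Lambda^2 (R^3)^* (x) R^3: C in W is coded by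
   the matrix with columns C(e2, e3), C(e3, e1), C(e1, e2), in this order.
   [bracketK], [bracket_bilinear_skew] and [brackets_of_mapK] show that
   [bracket] is a bijection onto the skew-symmetric bilinear maps. *)
Definition bracket (c : 'M[R]_3) (a b : 'cV[R]_3) : 'cV[R]_3 :=
  (a 1 0 * b 2 0 - a 2 0 * b 1 0) *: col 0 c
  + (a 2 0 * b 0 0 - a 0 0 * b 2 0) *: col 1 c
  + (a 0 0 * b 1 0 - a 1 0 * b 0 0) *: col 2 c.

(* The C with C(e2, e3) = u, C(e3, e1) = v and C(e1, e2) = w. *)
Definition brackets (u v w : 'cV[R]_3) : 'M[R]_3 :=
  \matrix_(i < 3, j < 3) ([:: u; v; w]`_j) i 0.

Definition brackets_of_map (f : 'cV[R]_3 -> 'cV[R]_3 -> 'cV[R]_3) : 'M[R]_3 :=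
  brackets (f e2 e3) (f e3 e1) (f e1 e2).

Definition bilinear_skew (f : 'cV[R]_3 -> 'cV[R]_3 -> 'cV[R]_3) : Prop :=
  (forall (k : R) (a a' b : 'cV[R]_3), f (k *: a + a') b = k *: f a b + f a' b)
  /\ (forall a b : 'cV[R]_3, f a b = - f b a).

Definition act (g c : 'M[R]_3) : 'M[R]_3 :=
  brackets_of_map (fun a b => g *m bracket c (invmx g *m a) (invmx g *m b)).

Definition orbit (c : 'M[R]_3) : set 'M[R]_3 :=
  [set act g c | g in [set g : 'M[R]_3 | g \in unitmx]].

Definition jacobi (c : 'M[R]_3) : Prop :=
  forall x y z : 'cV[R]_3,
    bracket c x (bracket c y z) + bracket c y (bracket c z x)
    + bracket c z (bracket c x y) = 0.

Definition X : set 'M[R]_3 := [set c | jacobi c].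

(* The GL_3(R)-orbits in X (all of them, not only those named below) that are
   contained in S. *)
Definition orbits_in (S : set 'M[R]_3) : set (set 'M[R]_3) :=
  [set O | (exists2 c, X c & O = orbit c) /\ O `<=` S].

Definition B_I : set 'M[R]_3 := orbit (brackets 0 0 0).
Definition B_II : set 'M[R]_3 := orbit (brackets e1 0 0).
Definition B_IV : set 'M[R]_3 := orbit (brackets (e1 - e2) e1 0).
Definition B_V : set 'M[R]_3 := orbit (brackets (- e2) e1 0).
Definition B_VI (h : R) : set 'M[R]_3 :=
  orbit (brackets (e1 - h *: e2) (h *: e1 - e2) 0).
Definition B_VII (h : R) : set 'M[R]_3 :=
  orbit (brackets (e1 - h *: e2) (h *: e1 + e2) 0).

Lemma bracket_bilinear_skew (c : 'M[R]_3) : bilinear_skew (bracket c).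
Proof.
by split=> [k a a' b | a b]; apply/colP => i; rewrite !mxE; ring.
Qed.

Lemma brackets_of_mapK (f : 'cV[R]_3 -> 'cV[R]_3 -> 'cV[R]_3) :
  bilinear_skew f -> bracket (brackets_of_map f) = f.
Proof.
move=> [fl fs].
have f0 b : f 0 b = 0.
  by have := fl (-1) 0 0 b; rewrite scaler0 addr0 scaleN1r addNr.
have fr k a b b' : f a (k *: b + b') = k *: f a b + f a b'.
  by rewrite fs fl opprD -scalerN -!fs.
have fz a b k : f (k *: a) b = k *: f a b.
  by rewrite -[k *: a]addr0 fl f0 addr0.
have frz a b k : f a (k *: b) = k *: f a b.
  by rewrite fs fz -scalerN -fs.
have faa a : f a a = 0.
  apply/colP => i; have /colP/(_ i) := fs a a; rewrite !mxE => /eqP.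
  by rewrite -addr_eq0 -mulr2n mulrn_eq0 /= => /eqP.
have dec (a : 'cV[R]_3) : a = a 0 0 *: e1 + (a 1 0 *: e2 + a 2 0 *: e3).
  apply/colP => i; rewrite !mxE.
  by case: i => [[|[|[|//]]] Hi] /=;
    rewrite ?(mulr1, mulr0, addr0, add0r); congr (a _ _); apply/val_inj.
apply/funext => a; apply/funext => b.
rewrite [in RHS](dec a) [in RHS](dec b) !fl !fz !fr !frz !faa.
rewrite (fs e2 e1) (fs e3 e2) (fs e1 e3).
by apply/colP => i; rewrite /brackets_of_map !mxE /=; ring.
Qed.

Lemma bracketsE (u v w : 'cV[R]_3) :
  [/\ bracket (brackets u v w) e2 e3 = u, bracket (brackets u v w) e3 e1 = v
    & bracket (brackets u v w) e1 e2 = w].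
Proof. by split; apply/colP => i; rewrite !mxE /=; ring. Qed.

Lemma bracketK (c : 'M[R]_3) : brackets_of_map (bracket c) = c.
Proof.
apply/matrixP => i j; rewrite !mxE.
by case: j => [[|[|[|//]]] Hj] /=; rewrite ?mxE /=;
  rewrite ?(mulr0, mul0r, mulr1, mul1r, oppr0, mul0r, add0r, addr0);
  congr (c _ _); apply/val_inj.
Qed.

Lemma bracket_act (g c : 'M[R]_3) (a b : 'cV[R]_3) :
  bracket (act g c) a b = g *m bracket c (invmx g *m a) (invmx g *m b).
Proof.
rewrite /act brackets_of_mapK //; have [cl cs] := bracket_bilinear_skew c.
split=> [k x x' y | x y]; last by rewrite cs mulmxN.
by rewrite (mulmxDr (invmx g)) -(scalemxAr k (invmx g)) cl mulmxDr scalemxAr.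
Qed.

End Brackets.

Arguments X : clear implicits.
Arguments B_I : clear implicits.
Arguments B_II : clear implicits.
Arguments B_IV : clear implicits.
Arguments B_V : clear implicits.

Section SemialgebraicDimension.
Variables (R : realType) (n : nat).

Inductive semialgebraic : set 'rV[R]_n -> Prop :=
| semialg_pos (p : mpoly.mpoly n R) :
    semialgebraic [set x | 0 < mpoly.meval (fun i => x 0 i) p]
| semialg_setU A B :
    semialgebraic A -> semialgebraic B -> semialgebraic (A `|` B)
| semialg_setI A B :
    semialgebraic A -> semialgebraic B -> semialgebraic (A `&` B)
| semialg_setC A : semialgebraic A -> semialgebraic (~` A).

Definition vanishing_ideal (A : set 'rV[R]_n) : set (mpoly.mpoly n R) :=
  [set p | forall x, A x -> mpoly.meval (fun i => x 0 i) p = 0].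

(* Chains P_0 < ... < P_d of prime ideals containing I; they correspond to the
   chains of length d of prime ideals in the quotient by I.  Properness of the
   P_i is part of [idealr_closed]. *)
Definition prime_chain (I : set (mpoly.mpoly n R)) (d : nat)
    (P : 'I_d.+1 -> {pred mpoly.mpoly n R}) : Prop :=
  [/\ forall i, idealr_closed (P i) /\ prime_idealr_closed (P i),
      forall i p, I p -> p \in P i
    & forall i j : 'I_d.+1, (i < j)%N ->
        {subset P i <= P j} /\ exists2 p, p \in P j & p \notin P i].

Definition krull_dim_quotient (I : set (mpoly.mpoly n R)) (d : nat) : Prop :=
  (exists P : 'I_d.+1 -> {pred mpoly.mpoly n R}, prime_chain I P)
  /\ forall (e : nat) (P : 'I_e.+1 -> {pred mpoly.mpoly n R}),
       prime_chain I P -> (e <= d)%N.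

(* A is semialgebraic of dimension d, the dimension being that of Bochnak,
   Coste and Roy (Real Algebraic Geometry, Def. 2.8.1): the Krull dimension of
   the ring R[x_1, ..., x_n] / I(A) of polynomial functions on A. *)
Definition semialgebraic_dim (A : set 'rV[R]_n) (d : nat) : Prop :=
  semialgebraic A /\ krull_dim_quotient (vanishing_ideal A) d.

End SemialgebraicDimension.

(* Main.v *)
Require Import Defs.
From mathcomp Require Import all_boot all_order all_algebra.

(** Coding a bracket by the matrix c with columns C(e2, e3), C(e3, e1),
C(e1, e2), the action becomes c |-> (det g)^-1 g c g^T.  Write c = S + [v] with
S symmetric and [v] skew.  The Jacobi identity says S v = 0, and S transforms so
that its cofactor matrix cof S and v v^T follow the same law; hence the equation
h^2 cof S = e (v v^T) is invariant.  Together with S v = 0, S <> 0 and v <> 0 it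
characterises the orbit of IV (h = 1, e = 0), VI_h (e = -1) and VII_h (e = 1),
by an explicit adapted frame.  These equations are closed and leave only the
degenerate orbits with v = 0 or S = 0 in the boundary; conversely all
degenerations are limits of paths of normal forms.

The union of the VII_h with h > 0 is {S v = 0, |v|^2 tr (cof S) > 0}.  It is
covered by three polynomial charts from R^6, so a chain of primes
P_0 < ... < P_e above its ideal has e <= 6: choosing y_i in P_i but not in
P_(i-1) gives e polynomials algebraically independent modulo P_0, while any
7 polynomials in 6 variables are algebraically dependent.  Pulling back
coordinate flags along one chart gives a chain of length 6. *)

(* The notations of [mpoly] clash with those of mathcomp-analysis, hence the
   module. *)
Module BracketAlgebra.
From mathcomp Require Import ring_quotient mpoly.
From mathcomp Require Import boolp classical_sets reals ring lra.
Import Order.TTheory GRing.Theory Num.Theory.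
Local Open Scope classical_set_scope.
Local Open Scope ring_scope.
Set Implicit Arguments.
Unset Strict Implicit.
Unset Printing Implicit Defensive.

(** * Krull dimension of polynomial rings modulo vanishing ideals *)

Lemma mpoly_no_var (R : nzRingType) (p : {mpoly R[0]}) : p = (p@_0)%:MP.
Proof.
apply/mpolyP => m; rewrite mcoeffC (_ : m = 0%MM) ?eqxx ?mulr1 //.
by apply/mnmP; case.
Qed.

(** * Polynomials in several variables as univariate polynomials in the last one *)

Section OneVariable.
Variables (R : nzRingType) (n : nat).
Local Notation widen := (widen_ord (leqnSn n)).

Lemma mcoeff_muni (p : {mpoly R[n.+1]}) (m : 'X_{1..n.+1}) :
  ((muni p)`_(m ord_max))@_[multinom m (widen i) | i < n] = p@_m.
Proof.
rewrite muniE coef_sum raddf_sum /=.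
have eqm (m' : 'X_{1..n.+1}) :
    (m ord_max == m' ord_max) &&
    ([multinom m' (widen i) | i < n] == [multinom m (widen i) | i < n]) =
    (m' == m).
  apply/andP/eqP => [[/eqP e1 /eqP /mnmP e2]|->]; last by rewrite !eqxx.
  apply/mnmP => i; have [lt_in|] := ltnP i n.
    have := e2 (Ordinal lt_in); rewrite !mnmE.
    by rewrite (_ : widen _ = i) //; apply/val_inj.
  move=> le_ni; rewrite (_ : i = ord_max) //; apply/val_inj/eqP => /=.
  by rewrite eqn_leq le_ni -ltnS ltn_ord.
have E m' : (p@_m' *: 'X_[R, [multinom m' (widen i) | i < n]] *:
      'X^(m' ord_max))`_(m ord_max)@_[multinom m (widen i) | i < n]
    = p@_m' * (m' == m)%:R.
  rewrite coefZ coefXn -eqm; case: (m ord_max == _); last first.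
    by rewrite mulr0 mcoeff0 mulr0.
  by rewrite mulr1 mcoeffZ mcoeffX.
rewrite (eq_bigr _ (fun m' _ => E m')).
have [msp|mNsp] := boolP (m \in msupp p).
  rewrite (bigD1_seq m) ?msupp_uniq //= eqxx mulr1 big1 ?addr0 // => i /negPf ->.
  by rewrite mulr0.
rewrite (memN_msupp_eq0 mNsp) big1_seq // => i /= isp.
have [im|_] := eqVneq i m; last by rewrite mulr0.
by rewrite -im isp in mNsp.
Qed.

Lemma muni_inj0 (p : {mpoly R[n.+1]}) : muni p = 0 -> p = 0.
Proof.
by move=> p0; apply/mpolyP => m; rewrite -mcoeff_muni p0 coef0 !mcoeff0.
Qed.

End OneVariable.

(** Horner evaluation in the last variable. Since [y] is indexed by [nat], the same valuation serves
    [n.+1] and [n] variables, which suits inductions. *)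
Lemma mmap_muni (R : comNzRingType) (A : comNzRingType) (f : {rmorphism R -> A})
    (n : nat) (y : nat -> A) (p : {mpoly R[n.+1]}) :
  mmap f (fun i : 'I_n.+1 => y i) p =
  (map_poly (mmap f (fun i : 'I_n => y i)) (muni p)).[y n].
Proof.
rewrite muniE raddf_sum /= horner_sum; apply: eq_bigr => m _.
rewrite map_polyZ map_polyXn hornerZ hornerXn /= mmapZ mmapX.
rewrite /mmap1 big_ord_recr /= mulrA; congr (_ * _ * _).
by apply: eq_bigr => i _; rewrite mnmE.
Qed.

Section Chain.
Variables (A : comNzRingType).

Lemma ideal_mul (P : {pred A}) (a u : A) : idealr_closed P -> u \in P -> a * u \in P.
Proof. by case=> P0 _ PD uP; rewrite -[a * u]addr0; exact: PD. Qed.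

Lemma ideal_subr (P : {pred A}) (u v : A) :
  idealr_closed P -> u \in P -> v \in P -> v - u \in P.
Proof. by case=> _ _ PD uP vP; rewrite -mulN1r addrC; exact: PD. Qed.

(** Induction on [e], with [p] read as a polynomial [q * 'X + c] evaluated at the last element
    [y e]. If [c = 0], primality of [Q e.+1] and [y e \notin Q e.+1] allow dividing by [y e]. If
    [c != 0], a value in [Q e.+1] would lie in [Q e] together with [y e], so the value of [c] would
    lie in [Q e], against the induction hypothesis. *)
Lemma prime_chain_indep (R : fieldType) (f : {rmorphism R -> A}) (e : nat)
    (Q : nat -> {pred A}) (y : nat -> A) :
  (forall k, (k <= e)%N -> idealr_closed (Q k) /\ prime_idealr_closed (Q k)) ->
  (forall k, (k < e)%N ->
     [/\ {subset Q k.+1 <= Q k}, y k \in Q k & y k \notin Q k.+1]) ->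
  forall p : {mpoly R[e]}, p != 0 -> mmap f (fun i : 'I_e => y i) p \notin Q e.
Proof.
elim: e => [|e IHe] Qid Qch p p0.
  have c0 : p@_0 != 0.
    by apply: contra_neq p0 => c0; rewrite (mpoly_no_var p) c0 mpolyC0.
  rewrite (mpoly_no_var p) mmapC; have [Q0 _] := Qid 0%N (leqnn _).
  apply/negP => /(ideal_mul (f (p@_0)^-1) Q0).
  by rewrite -rmorphM /= mulVf // rmorph1; case: Q0 => _ /negP.
have [sub yin yout] := Qch e (ltnSn e).
have [Qe1 Qe1p] := Qid _ (leqnn e.+1).
have [Qe _] := Qid _ (leqnSn e).
rewrite mmap_muni; have : muni p != 0 by apply: contra_neq p0; exact: muni_inj0.
elim/poly_ind: (muni p) => [|q c IHq]; first by rewrite eqxx.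
rewrite rmorphD rmorphM /= map_polyX map_polyC /= !hornerE => qc0.
have [c0|c0] := eqVneq c 0.
  rewrite c0 rmorph0 addr0; apply/negP => /Qe1p; rewrite (negPf yout) orbF.
  apply/negP/IHq; apply: contra_neq qc0 => ->.
  by rewrite mul0r add0r c0 polyC0.
apply/negP => /sub; set v := _.[_] => h.
have /negP : mmap f (fun i : 'I_e => y i) c \notin Q e.
  by apply: IHe c0 => k ke; [apply: Qid|apply: Qch]; exact: leqW.
apply; have := ideal_subr Qe (ideal_mul v Qe yin) h.
by rewrite addrAC subrr add0r.
Qed.

End Chain.

(** * More polynomials than variables are algebraically dependent *)

Section AlgebraicDependence.
Variables (R : fieldType).

(** [msize] is the degree plus one, and 0 for the zero polynomial; bounds of the form [a.+1] mean
    degree at most [a] and cover zero uniformly. *)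
Lemma msize_mul (n : nat) (p q : {mpoly R[n]}) (a b : nat) :
  (msize p <= a.+1)%N -> (msize q <= b.+1)%N -> (msize (p * q) <= (a + b).+1)%N.
Proof.
move=> pa qb; have [->|p0] := eqVneq p 0; first by rewrite mul0r msize0.
have [->|q0] := eqVneq q 0; first by rewrite mulr0 msize0.
rewrite msizeM // -subn1 leq_subLR add1n; apply: leq_trans (leq_add pa qb) _.
by rewrite addSn addnS.
Qed.

Lemma msize_exp (n : nat) (p : {mpoly R[n]}) (a k : nat) :
  (msize p <= a.+1)%N -> (msize (p ^+ k) <= (k * a).+1)%N.
Proof.
move=> pa; elim: k => [|k IH]; first by rewrite expr0 msize1.
by rewrite exprS mulSn; exact: msize_mul.
Qed.

Lemma msize_prod (n : nat) (I : Type) (s : seq I) (P : pred I)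
    (p : I -> {mpoly R[n]}) (a : I -> nat) :
  (forall i, P i -> (msize (p i) <= (a i).+1)%N) ->
  (msize (\prod_(i <- s | P i) p i)%R <= (\sum_(i <- s | P i) a i).+1)%N.
Proof.
move=> pa; elim/big_ind2: _ => [|u v x z ux vz|//]; first by rewrite msize1.
exact: msize_mul.
Qed.

(* A count of monomials: the N^m products of powers with exponents below N lie
   in a space of dimension O(N^n). *)
Lemma algebraic_dependence (m n : nat) (y : 'I_m -> {mpoly R[n]}) :
  (n < m)%N -> exists2 p : {mpoly R[m]}, p != 0 & mmap (@mpolyC n R) y p = 0.
Proof.
move=> nm; pose D := (\max_i msize (y i))%N.
have yD i : (msize (y i) <= D.+1)%N by apply: leqW; exact: leq_bigmax.
(* The products have degree at most [m * N * D], hence below [B]. There are [N ^ m] of them, against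
   [B ^ n = N ^ n * K ^ n] exponent vectors; as [K ^ n < N], the latter number is below
   [N ^ n.+1 <= N ^ m]. *)
pose K := (m * D).+1; pose N := (K ^ n).+1; pose B := (N * K)%N.
pose mono (a : {ffun 'I_m -> 'I_N}) := \prod_i y i ^+ a i.
have monoB a : (msize (mono a) <= B)%N.
  apply: leq_trans (msize_prod (a := fun i => (a i * D)%N) _ _) _.
    by move=> i _; exact: msize_exp.
  rewrite /B /K mulnS; apply: (@leq_trans (m * (N * D)).+1); last first.
    by rewrite mulnCA addSn ltnS leq_addl.
  rewrite ltnS -[X in (X * _)%N]card_ord -sum_nat_const; apply: leq_sum => i _.
  by rewrite leq_mul2r (ltnW (ltn_ord (a i))) orbT.
pose rows := {ffun 'I_m -> 'I_N}; pose cols := {ffun 'I_n -> 'I_B}.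
pose M : 'M[R]_(#|rows|, #|cols|) := \matrix_(i, j)
  (mono (enum_val i))@_[multinom nat_of_ord ((enum_val j : cols) k) | k < n].
have card : (#|cols| < #|rows|)%N.
  rewrite !card_ffun !card_ord /B expnMn.
  apply: (@leq_trans (N ^ n.+1)); last by rewrite leq_exp2l // ltnS expn_gt0.
  by rewrite expnSr ltn_pmul2l ?ltnSn ?expn_gt0.
have [u u0 uM] : exists2 u : 'rV_#|rows|, u != 0 & u *m M = 0.
  have : kermx M != 0.
    rewrite -mxrank_eq0 mxrank_ker subn_eq0 -ltnNge.
    exact: leq_ltn_trans (rank_leq_col M) card.
  by move=> /rowV0Pn[u /sub_kermxP uM u0]; exists u.
pose F : {mpoly R[m]} :=
  \sum_i u 0 i *: 'X_[[multinom nat_of_ord ((enum_val i : rows) k) | k < m]].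
exists F.
  apply: contra_neq u0 => F0; apply/rowP => i; rewrite mxE.
  have := congr1 (mcoeff [multinom nat_of_ord ((enum_val i : rows) k) | k < m]) F0.
  rewrite mcoeff0 raddf_sum (bigD1 i) //= mcoeffZ mcoeffX eqxx mulr1.
  rewrite big1 ?addr0 // => j ji; rewrite mcoeffZ mcoeffX.
  case: eqP; last by rewrite mulr0.
  move=> /mnmP e; case/eqP: ji; apply: enum_val_inj; apply/ffunP => k.
  by apply: val_inj; have := e k; rewrite !mnmE.
rewrite raddf_sum /=; apply/mpolyP => d; rewrite mcoeff0 raddf_sum /=.
have term i : mmap (@mpolyC n R) y
    (u 0 i *: 'X_[[multinom nat_of_ord ((enum_val i : rows) k) | k < m]])
    = u 0 i *: mono (enum_val i).
  rewrite mmapZ mmapX mul_mpolyC /mmap1; congr (_ *: _).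
  by apply: eq_bigr => k _; rewrite mnmE.
rewrite (eq_bigr _ (fun i _ => congr1 (mcoeff d) (term i))).
(* If all exponents of [d] are below [B], the coefficient is an entry of [u *m M]; otherwise [d]
   exceeds the degree of every product. *)
have [dB|] := boolP [forall k, d k < B]%N.
  pose b : cols := [ffun k => Ordinal (forallP dB k)].
  have /rowP/(_ (enum_rank b)) := uM; rewrite !mxE; apply: etrans.
  apply: eq_bigr => i _; rewrite mcoeffZ mxE enum_rankK; congr (_ * _@__).
  by apply/mnmP => k; rewrite mnmE ffunE.
rewrite negb_forall => /existsP[k]; rewrite -leqNgt => Bk.
apply: big1 => i _; rewrite mcoeffZ memN_msupp_eq0 ?mulr0 //.
apply/msize_mdeg_ge/(leq_trans (monoB _))/(leq_trans Bk).
by rewrite mdegE (bigD1 k) //= leq_addr.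
Qed.

End AlgebraicDependence.

Section Substitution.
Variables (R : comNzRingType) (n k : nat).

Lemma meval_mmap (h : 'I_n -> {mpoly R[k]}) (p : {mpoly R[n]}) (u : 'I_k -> R) :
  (mmap (@mpolyC k R) h p).@[u] = p.@[fun j => (h j).@[u]].
Proof.
have -> : mmap (@mpolyC k R) h p = \sum_(m <- msupp p) (p@_m)%:MP * mmap1 h m by [].
rewrite raddf_sum; apply: eq_bigr => m _; rewrite /= rmorphM /= mevalC rmorph_prod.
by congr (_ * _); apply: eq_bigr => j _; rewrite rmorphXn.
Qed.

Lemma mmap_mmap (l : nat) (h : 'I_n -> {mpoly R[k]}) (g : 'I_k -> {mpoly R[l]})
    (p : {mpoly R[n]}) :
  mmap (@mpolyC l R) g (mmap (@mpolyC k R) h p) =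
  mmap (@mpolyC l R) (fun j => mmap (@mpolyC l R) g (h j)) p.
Proof.
have -> : mmap (@mpolyC k R) h p = \sum_(m <- msupp p) (p@_m)%:MP * mmap1 h m by [].
rewrite raddf_sum; apply: eq_bigr => m _; rewrite /= rmorphM /= mmapC rmorph_prod.
by congr (_ * _); apply: eq_bigr => j _; rewrite rmorphXn.
Qed.

Lemma eq_mmap (h g : 'I_n -> {mpoly R[k]}) (p : {mpoly R[n]}) :
  h =1 g -> mmap (@mpolyC k R) h p = mmap (@mpolyC k R) g p.
Proof. by move=> hg; apply: eq_bigr => m _; rewrite (mmap1_eq _ hg). Qed.

End Substitution.

(** * Bounds for the Krull dimension from polynomial parametrizations *)

Section KrullDimensionBounds.
Variable R : realType.

(** Induction on [n]: with the other variables specialized to [v], the polynomial in the last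
    variable vanishes at more distinct integers than its degree. *)
Lemma mpoly_eq0 (n : nat) (p : {mpoly R[n]}) :
  (forall v : 'I_n -> R, p.@[v] = 0) -> p = 0.
Proof.
elim: n p => [|n IHn] p p0.
  by move: (p0 (fun=> 0)); rewrite (mpoly_no_var p) mevalC => ->.
apply/muni_inj0/polyP => k; rewrite coef0; apply: IHn => v.
pose y x i := if insub i is Some j then v j else x.
have evE x : (map_poly (meval v) (muni p)).[x] = 0.
  have yn : y x n = x by rewrite /y insubF ?ltnn.
  have := mmap_muni idfun (y x) p; rewrite yn => h.
  rewrite -[RHS](p0 (y x)) /meval h; congr _.[x]; apply: eq_map_poly => q.
  by apply: meval_eq => i; rewrite /y valK.
rewrite -coef_map /= (_ : map_poly _ _ = 0) ?coef0 //.
pose s := [seq (i%:R : R) | i <- iota 0 (size (map_poly (meval v) (muni p)))].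
apply: (@roots_geq_poly_eq0 _ _ s); last by rewrite size_map size_iota.
  by apply/allP => x _; rewrite rootE evE.
rewrite map_inj_uniq ?iota_uniq // => i j /eqP.
by rewrite Num.Theory.eqr_nat => /eqP.
Qed.

(** If [e > k], the elements [y j] separating consecutive primes satisfy, after pullback to any
    chart [i], a relation [F i]. The product of these relations vanishes on all charts, hence on
    [A], so its value at [y] lies in the smallest prime, against [prime_chain_indep]. *)
Lemma prime_chain_le (n k : nat) (I : finType)
    (phi : I -> 'I_n -> {mpoly R[k]}) (A : 'rV[R]_n -> Prop) (e : nat)
    (P : 'I_e.+1 -> {pred {mpoly R[n]}}) :
  (forall x, A x -> exists i u, forall j, x 0 j = (phi i j).@[u]) ->
  prime_chain (vanishing_ideal A) P -> (e <= k)%N.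
Proof.
move=> cov [Pid PI Plt]; rewrite leqNgt; apply/negP => ke.
(* The chain is reversed because [prime_chain_indep] takes a decreasing one; [Q e] is [P 0]. *)
pose Q j := P (inord (e - j)).
have Qlt j (je : (j < e)%N) :
    {subset Q j.+1 <= Q j} /\ exists2 p, p \in Q j & p \notin Q j.+1.
  by apply: Plt; rewrite !inordK ?ltnS ?leq_subr // ltn_sub2l.
have /boolp.choice[y yQ] :
    forall j, exists p, (j < e)%N -> p \in Q j /\ p \notin Q j.+1.
  move=> j; have [je|] := ltnP j e; last by exists 0.
  by have [_ [p pj pj1]] := Qlt j je; exists p.
pose z i (j : 'I_e) : {mpoly R[k]} := mmap (@mpolyC k R) (phi i) (y j).
have /boolp.choice[F F0] : forall i, exists p : {mpoly R[e]},
    p != 0 /\ mmap (@mpolyC k R) (z i) p = 0.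
  by move=> i; have [p] := algebraic_dependence (z i) ke; exists p.
have : mmap (@mpolyC n R) (fun i : 'I_e => y i) (\prod_i F i) \notin Q e.
  apply: prime_chain_indep => [j _|j je|].
  - exact: Pid.
  - by have [? _] := Qlt j je; have [] := yQ j je.
  - by apply/prodf_neq0 => i _; have [] := F0 i.
apply/negP; rewrite negbK; apply: PI => x /cov[i [u xu]].
rewrite (bigD1 i) //= !rmorphM /= [X in X * _](_ : _ = 0) ?mul0r //.
transitivity (mmap (@mpolyC k R) (z i) (F i)).@[u]; last first.
  by rewrite (proj2 (F0 i)) meval0.
rewrite !meval_mmap; apply: meval_eq => j; rewrite meval_mmap.
exact: meval_eq.
Qed.

(** The [i]-th prime is the kernel of pulling back along [phi] and then setting the first [i]
    variables to 0; it is prime because the target is a domain. It contains the vanishing ideal: the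
    pullback of such a [p], times [d], vanishes everywhere. The [z i] make the inclusions strict. *)
Lemma exists_prime_chain (n k : nat) (phi : 'I_n -> {mpoly R[k]})
    (A : 'rV[R]_n -> Prop) (d : {mpoly R[k]}) (z : 'I_k -> {mpoly R[n]}) :
  let cut i := fun j : 'I_k => if (j < i)%N then 0 else 'X_j : {mpoly R[k]} in
  d != 0 ->
  (forall u : 'I_k -> R, d.@[u] != 0 -> A (\row_j (phi j).@[u])) ->
  (forall i : 'I_k,
     mmap (@mpolyC k R) (cut i) (mmap (@mpolyC k R) phi (z i)) != 0) ->
  (forall i : 'I_k,
     mmap (@mpolyC k R) (cut i.+1) (mmap (@mpolyC k R) phi (z i)) = 0) ->
  exists P : 'I_k.+1 -> {pred {mpoly R[n]}}, prime_chain (vanishing_ideal A) P.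
Proof.
move=> cut d0 dA z1 z0.
pose ev (i : nat) (p : {mpoly R[n]}) :=
  mmap (@mpolyC k R) (cut i) (mmap (@mpolyC k R) phi p).
have evS i j p : (i <= j)%N -> ev i p = 0 -> ev j p = 0.
  move=> ij; rewrite /ev; move: (mmap _ phi p) => q q0.
  rewrite (_ : mmap _ _ q = mmap (@mpolyC k R) (cut j) (mmap (@mpolyC k R) (cut i) q)).
    by rewrite q0 mmap0.
  rewrite mmap_mmap; apply: eq_mmap => l; rewrite /cut.
  by case: (ltnP l i) => li; rewrite ?mmap0 ?mmapX ?mmap1U // (leq_trans li).
exists (fun i p => ev i p == 0); split.
- move=> i; split; first split => [||a p q].
  + by rewrite unfold_in /ev !rmorph0.
  + by rewrite unfold_in /ev !rmorph1 oner_eq0.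
  + rewrite !unfold_in /ev !rmorphD !rmorphM /= => /eqP-> /eqP->.
    by rewrite mulr0 addr0.
  + by move=> p q; rewrite !unfold_in /ev !rmorphM /= mulf_eq0.
- move=> i p Ip; rewrite unfold_in /ev (_ : mmap _ phi p = 0) ?mmap0 //.
  apply/eqP; rewrite -(inj_eq (mulfI d0)) mulr0; apply/eqP/mpoly_eq0 => u.
  rewrite rmorphM /= meval_mmap.
  have [->|/dA/Ip pu] := eqVneq d.@[u] 0; first by rewrite mul0r.
  suff -> : p.@[fun j => (phi j).@[u]] = 0 by rewrite mulr0.
  by apply: etrans pu; apply: meval_eq => j; rewrite mxE.
- move=> i j ij; split=> [p|]; first by move=> /eqP/(evS _ _ _ (ltnW ij))/eqP.
  have ik : (i < k)%N by rewrite (leq_trans ij) // -ltnS.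
  exists (z (Ordinal ik)); last exact: z1 (Ordinal ik).
  by apply/eqP/(evS i.+1) => //; exact: z0 (Ordinal ik).
Qed.

End KrullDimensionBounds.

(** * Symmetric and axial parts of a bracket *)

Lemma forall_ord3 (P : 'I_3 -> Prop) : P 0 -> P 1 -> P 2 -> forall i, P i.
Proof.
move=> P0 P1 P2 [[|[|[|//]]] i3].
- by rewrite (_ : Ordinal i3 = 0) //; exact/val_inj.
- by rewrite (_ : Ordinal i3 = 1) //; exact/val_inj.
- by rewrite (_ : Ordinal i3 = 2) //; exact/val_inj.
Qed.

Lemma sum_ord3 (T : nmodType) (F : 'I_3 -> T) : \sum_i F i = F 0 + F 1 + F 2.
Proof.
rewrite !big_ord_recl big_ord0 addr0 addrA.
by congr (F _ + F _ + F _); exact/val_inj.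
Qed.

Lemma ord3E : (0 + 1 = 1 :> 'I_3) * (1 + 1 = 2 :> 'I_3) * (2 + 1 = 0 :> 'I_3) *
  (0 + 2 = 2 :> 'I_3) * (1 + 2 = 0 :> 'I_3) * (2 + 2 = 1 :> 'I_3) *
  (0 + 0 = 0 :> 'I_3) * (1 + 0 = 1 :> 'I_3) * (2 + 0 = 2 :> 'I_3).
Proof. by do !split; exact/val_inj. Qed.

Section Invariants.
Variable T : comNzRingType.
Implicit Type c : 'M[T]_3.

(* [c = (sym c + [axial c]) / 2], where [[v]] is a skew matrix with
   [[v] x = - v * x] (cross product).  *)
Definition sym c : 'M[T]_3 := c + c^T.
Definition axial c (i : 'I_3) : T := c (i + 1) (i + 2) - c (i + 2) (i + 1).
(** Indices are taken modulo 3, and this cyclic form absorbs the signs of the cofactors. *)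
Definition cof (s : 'M[T]_3) (i j : 'I_3) : T :=
  s (i + 1) (j + 1) * s (i + 2) (j + 2) - s (i + 1) (j + 2) * s (i + 2) (j + 1).
Definition jac c (i : 'I_3) : T := \sum_j sym c i j * axial c j.
Definition disc c : T := (\sum_i axial c i ^+ 2) * (\sum_i cof (sym c) i i).

(** Conjugation by a cyclic permutation of the basis; it moves any chosen axial coordinate to index
    2. *)
Definition shift (k : 'I_3) c : 'M[T]_3 := \matrix_(i, j) c (i + k) (j + k).

Lemma axial_shift k c i : axial (shift k c) i = axial c (i + k).
Proof. by rewrite /axial !mxE !(addrAC _ _ k). Qed.

Lemma sym_shift k c i j : sym (shift k c) i j = sym c (i + k) (j + k).
Proof. by rewrite !mxE. Qed.

Lemma jac_shift k c i : jac (shift k c) i = jac c (i + k).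
Proof.
rewrite /jac [RHS](reindex_inj (addIr k)) /=.
by apply: eq_bigr => j _; rewrite sym_shift axial_shift.
Qed.

Lemma disc_shift k c : disc (shift k c) = disc c.
Proof.
rewrite /disc [in RHS](reindex_inj (addIr k)).
rewrite [X in _ = _ * X](reindex_inj (addIr k)) /=.
congr (_ * _); apply: eq_bigr => i _; first by rewrite axial_shift.
by rewrite /cof !sym_shift !(addrAC _ _ k).
Qed.

(* A point with nonzero third axial coordinate [s] is determined by the block
   [[a, a b], [a b, a (b^2 + c^2)]] of the symmetric part and the ratios
   [x], [y] of the axial coordinates.  The square [c^2] encodes that the block
   has positive determinant. *)
Definition chart0 (u : 'I_6 -> T) : 'M[T]_3 :=
  let b := u 0 in let c := u 1 in let a := u 2 in
  let x := u 3 in let y := u 4 in let s := u 5 in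
  let s11 := a in let s12 := a * b in let s22 := a * (b ^+ 2 + c ^+ 2) in
  let s13 := - (x * s11 + y * s12) in let s23 := - (x * s12 + y * s22) in
  let s33 := - (x * s13 + y * s23) in
  \matrix_(i, j) nth 0 (nth [::] [::
    [:: s11; s12 + s; s13 - y * s];
    [:: s12 - s; s22; s23 + x * s];
    [:: s13 + y * s; s23 - x * s; s33]] i) j.

Definition chart k u := shift k (chart0 u).

End Invariants.

Section Morphism.
Variables (T U : comNzRingType) (f : {rmorphism T -> U}).

Lemma sym_map c i j : sym (map_mx f c) i j = f (sym c i j).
Proof. by rewrite !mxE rmorphD. Qed.

Lemma axial_map c i : axial (map_mx f c) i = f (axial c i).
Proof. by rewrite /axial !mxE rmorphB. Qed.

Lemma jac_map c i : jac (map_mx f c) i = f (jac c i).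
Proof.
rewrite /jac rmorph_sum; apply: eq_bigr => j _.
by rewrite rmorphM sym_map axial_map.
Qed.

Lemma disc_map c : disc (map_mx f c) = f (disc c).
Proof.
rewrite /disc rmorphM !rmorph_sum /=; congr (_ * _); apply: eq_bigr => i _.
  by rewrite rmorphXn axial_map.
by rewrite /cof !sym_map rmorphB !rmorphM.
Qed.

Lemma chart0_map u : map_mx f (chart0 u) = chart0 (f \o u).
Proof.
apply/matrixP; apply: forall_ord3; apply: forall_ord3; rewrite !mxE /=;
by rewrite ?(rmorphD, rmorphN, rmorphM, rmorphXn).
Qed.

Lemma chart_map k u : map_mx f (chart k u) = chart k (f \o u).
Proof. by rewrite /chart -chart0_map; apply/matrixP => i j; rewrite !mxE. Qed.

End Morphism.

Section Cofactors.
Variable T : comNzRingType.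
Implicit Type c : 'M[T]_3.

Lemma symC c i j : sym c i j = sym c j i.
Proof. by rewrite !mxE addrC. Qed.

Lemma cofC c i j : cof (sym c) i j = cof (sym c) j i.
Proof. by rewrite /cof !(symC c (j + _)); congr (_ - _); rewrite mulrC. Qed.

Lemma mxE_sym_axial c i :
  [/\ c i i *+ 2 = sym c i i,
      c (i + 1) (i + 2) *+ 2 = sym c (i + 1) (i + 2) + axial c i
    & c (i + 2) (i + 1) *+ 2 = sym c (i + 1) (i + 2) - axial c i].
Proof. by rewrite /axial !mxE; split; ring. Qed.

(* [(r_1 x r_2) x v = (r_1 v) r_2 - (r_2 v) r_1] for two rows of [sym c]. *)
Lemma cof_cross_axial c j i :
  cof (sym c) j (i + 1) * axial c (i + 2) - cof (sym c) j (i + 2) * axial c (i + 1) =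
  sym c (j + 2) i * jac c (j + 1) - sym c (j + 1) i * jac c (j + 2).
Proof.
by rewrite /jac !sum_ord3 /cof; elim/forall_ord3: i; rewrite !ord3E; ring.
Qed.

(** Division-free form of [cof S] being a multiple of [v v^T]: as [S v = 0], each row of [cof S] has
    zero cross product with [v], and [cof S] is symmetric. *)
Lemma cof_axial c i j k l : (forall i, jac c i = 0) ->
  cof (sym c) i j * axial c k * axial c l = cof (sym c) k l * axial c i * axial c j.
Proof.
move=> jac0.
have swap a b d : cof (sym c) a b * axial c d = cof (sym c) a d * axial c b.
  have cross m := cof_cross_axial c a m.
  have {}cross m : cof (sym c) a (m + 1) * axial c (m + 2) =
      cof (sym c) a (m + 2) * axial c (m + 1).
    by apply/eqP; rewrite -subr_eq0 cross !jac0 !mulr0 subrr.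
  move: (cross 0) (cross 1) (cross 2); rewrite !ord3E.
  by elim/forall_ord3: b; elim/forall_ord3: d.
by rewrite swap (cofC c i k) mulrAC swap.
Qed.

Lemma cofE c i j : (forall i, jac c i = 0) ->
  (\sum_k axial c k ^+ 2) * cof (sym c) i j =
  (\sum_k cof (sym c) k k) * axial c i * axial c j.
Proof.
move=> jac0; rewrite -mulrA !mulr_suml; apply: eq_bigr => k _.
by rewrite mulrA (cof_axial k k i j jac0); ring.
Qed.

End Cofactors.

Lemma jac_chart0 (R : comNzRingType) (u : 'I_6 -> R) i : jac (chart0 u) i = 0.
Proof.
by rewrite /jac sum_ord3 /axial; elim/forall_ord3: i; rewrite !ord3E !mxE /=; ring.
Qed.

Lemma disc_chart0 (R : comNzRingType) (u : 'I_6 -> R) :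
  disc (chart0 u) = (4 * u 2 * u 1 * u 5) ^+ 2 * (u 3 ^+ 2 + u 4 ^+ 2 + 1) ^+ 2.
Proof.
by rewrite /disc !sum_ord3 /axial /cof !ord3E !mxE /=; ring.
Qed.

Lemma chart0_surj (R : rcfType) (c : 'M[R]_3) :
  (forall i, jac c i = 0) -> 0 < disc c -> axial c 2 != 0 ->
  exists u, c = chart0 u.
Proof.
move=> jac0 disc_gt0 v2.
(* By [cofE] this minor has the sign of the trace of the cofactor matrix, since the axial coordinate
   at 2 is nonzero. *)
have cof_gt0 : 0 < cof (sym c) 2 2.
  have v_gt0 : 0 < \sum_k axial c k ^+ 2.
    rewrite sum_ord3 ltr_wpDl ?addr_ge0 ?sqr_ge0 //.
    by rewrite lt_def sqrf_eq0 v2 sqr_ge0.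
  have v22 : 0 < axial c 2 * axial c 2 by rewrite -expr2 exprn_even_gt0.
  rewrite -(pmulr_rgt0 _ v_gt0) cofE // -mulrA mulr_gt0 //.
  by move: disc_gt0; rewrite /disc pmulr_rgt0.
have [c00 c12 c21] := mxE_sym_axial c 0; have [c11 c20 c02] := mxE_sym_axial c 1.
have [c22 c01 c10] := mxE_sym_axial c 2.
move: c00 c11 c22 c12 c21 c20 c02 c01 c10 (jac0 0) (jac0 1) (jac0 2) cof_gt0 v2.
rewrite /jac /cof !sum_ord3 !ord3E (symC c 1 0) (symC c 2 0) (symC c 2 1).
move: (axial c) (sym c) => v s c00 c11 c22 c12 c21 c20 c02 c01 c10 J0 J1 J2 cof v2.
have s00 : s 0 0 != 0.
  apply: contraTneq cof => ->; rewrite mul0r sub0r oppr_gt0 -leNgt -expr2.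
  exact: sqr_ge0.
(* The parameters [b], [c], [a], [x], [y], [s] in this order; the halves undo the doubling in [sym]
   and [axial]. The third row and column of [s] are then forced by [S v = 0], solved through
   [v 2 != 0]. *)
exists (fun i : 'I_6 => nth 0 [:: s 0 1 / s 0 0;
  Num.sqrt (s 0 0 * s 1 1 - s 0 1 * s 0 1) / s 0 0; s 0 0 / 2;
  v 0 / v 2; v 1 / v 2; v 2 / 2] i).
have inj2 (x y : R) : x *+ 2 = y *+ 2 -> x = y.
  by move=> /eqP; rewrite eqrMn2r // => /eqP.
have sq : (Num.sqrt (s 0 0 * s 1 1 - s 0 1 * s 0 1) / s 0 0) ^+ 2 =
    (s 0 0 * s 1 1 - s 0 1 * s 0 1) / s 0 0 ^+ 2.
  by rewrite expr_div_n sqr_sqrtr ?ltW.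
have s11 : s 0 0 / 2 * ((s 0 1 / s 0 0) ^+ 2 +
    (s 0 0 * s 1 1 - s 0 1 * s 0 1) / s 0 0 ^+ 2) = s 1 1 / 2 by field.
have s01 : s 0 0 / 2 * (s 0 1 / s 0 0) = s 0 1 / 2 by field.
have s02 : - (v 0 / v 2 * (s 0 0 / 2) + v 1 / v 2 * (s 0 1 / 2)) = s 0 2 / 2.
  have h : s 0 2 * v 2 = - (s 0 0 * v 0 + s 0 1 * v 1) by move: J0; lra.
  by apply: (mulIf v2); rewrite [RHS]mulrAC h; field.
have s12 : - (v 0 / v 2 * (s 0 1 / 2) + v 1 / v 2 * (s 1 1 / 2)) = s 1 2 / 2.
  have h : s 1 2 * v 2 = - (s 0 1 * v 0 + s 1 1 * v 1) by move: J1; lra.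
  by apply: (mulIf v2); rewrite [RHS]mulrAC h; field.
have s22 : - (v 0 / v 2 * (s 0 2 / 2) + v 1 / v 2 * (s 1 2 / 2)) = s 2 2 / 2.
  have h : s 2 2 * v 2 = - (s 0 2 * v 0 + s 1 2 * v 1) by move: J2; lra.
  by apply: (mulIf v2); rewrite [RHS]mulrAC h; field.
apply/matrixP; apply: forall_ord3; apply: forall_ord3; rewrite mxE /=;
  rewrite ?sq ?s11 ?s01 ?s02 ?s12 ?s22; apply: inj2;
  rewrite ?(c00, c11, c22, c12, c21, c20, c02, c01, c10); by field; rewrite ?v2.
Qed.

(** * The set [S v = 0], [disc > 0] is semialgebraic of dimension 6 *)

Section Dimension.
Variable R : realType.

Definition jac0_disc_gt0 : set 'rV[R]_(3 * 3) :=
  [set x | (forall i, jac (vec_mx x) i = 0) /\ 0 < disc (vec_mx x)].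

(** Evaluating the invariants, defined over any commutative ring, at this matrix turns them into
    polynomials in the nine entries. *)
Definition generic : 'M[{mpoly R[3 * 3]}]_3 := \matrix_(i, j) 'X_(mxvec_index i j).

Lemma meval_generic (x : 'rV[R]_(3 * 3)) :
  map_mx (meval (fun i => x 0 i)) generic = vec_mx x.
Proof. by apply/matrixP => i j; rewrite !mxE mevalXU. Qed.

Lemma semialgebraic_eq0 (n : nat) (p : {mpoly R[n]}) :
  semialgebraic [set x : 'rV[R]_n | p.@[fun i => x 0 i] = 0].
Proof.
have -> : [set x : 'rV[R]_n | p.@[fun i => x 0 i] = 0] =
    ~` ([set x | 0 < p.@[fun i => x 0 i]] `|` [set x | 0 < (- p).@[fun i => x 0 i]]).
  apply/predeqP => x /=; rewrite mevalN oppr_gt0.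
  split=> [->|/not_orP[/negP p1 /negP p2]]; first by rewrite ltxx => -[].
  by apply/eqP; rewrite eq_le !leNgt p1 p2.
by apply/semialg_setC/semialg_setU; exact: semialg_pos.
Qed.

Lemma semialgebraic_jac0_disc_gt0 : semialgebraic jac0_disc_gt0.
Proof.
pose Z i := [set x : 'rV[R]_(3 * 3) | (jac generic i).@[fun i => x 0 i] = 0].
have -> : jac0_disc_gt0 = (Z 0 `&` Z 1 `&` Z 2) `&`
    [set x | 0 < (disc generic).@[fun i => x 0 i]].
  apply/predeqP => x; rewrite /jac0_disc_gt0 /Z /= -!jac_map -disc_map meval_generic.
  split=> [[j d]|[[[j0 j1] j2] d]]; first by rewrite !j.
  by split=> //; exact: forall_ord3.
by apply: semialg_setI (semialg_pos _); do ! apply: semialg_setI;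
  exact: semialgebraic_eq0.
Qed.

Definition chart_poly (k : 'I_3) (j : 'I_(3 * 3)) : {mpoly R[6]} :=
  mxvec (chart k (fun i : 'I_6 => 'X_i)) 0 j.

Lemma meval_chart_poly (k : 'I_3) (u : 'I_6 -> R) (j : 'I_(3 * 3)) :
  (chart_poly k j).@[u] = mxvec (chart k u) 0 j.
Proof.
transitivity (map_mx (meval u) (mxvec (chart k (fun i : 'I_6 => 'X_i))) 0 j).
  by rewrite mxE.
rewrite map_mxvec chart_map; congr (mxvec (chart k _) 0 j).
by apply/funext => i /=; rewrite mevalXU.
Qed.

Lemma chart_poly_surj (x : 'rV[R]_(3 * 3)) : jac0_disc_gt0 x ->
  exists k u, forall j, x 0 j = (chart_poly k j).@[u].
Proof.
move=> [jac0 disc_gt0].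
have [k vk] : exists k, axial (vec_mx x) (2 + k) != 0.
  apply/not_existsP => v0; have {}v0 k : axial (vec_mx x) k = 0.
    by have /negP := v0 (k - 2); rewrite addrC subrK negbK => /eqP.
  by move: disc_gt0; rewrite /disc big1 ?mul0r ?ltxx // => k _; rewrite v0 expr0n.
have [|||u uE] := @chart0_surj _ (shift k (vec_mx x)).
- by move=> i; rewrite jac_shift.
- by rewrite disc_shift.
- by rewrite axial_shift.
(* The chart of index [- k] undoes the shift by [k]. *)
exists (- k), u => j; rewrite meval_chart_poly /chart -uE -[x in LHS]vec_mxK.
by congr (mxvec _ 0 j); apply/matrixP => a b; rewrite !mxE !subrK.
Qed.

(* Coordinates vanishing one after the other when [b, c, a, x, y, s] are set to
   0 in this order. *)
Definition flag (i : 'I_6) : {mpoly R[3 * 3]} :=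
  nth 0 [:: sym generic 0 1; sym generic 1 1; sym generic 0 0;
            axial generic 0; axial generic 1; axial generic 2] i.

Lemma dim_jac0_disc_gt0 : krull_dim_quotient (vanishing_ideal jac0_disc_gt0) 6.
Proof.
split; last first.
  move=> e P chain; apply: (prime_chain_le _ chain (phi := chart_poly)).
  exact: chart_poly_surj.
pose w (i : nat) (j : 'I_6) : R := (i <= j)%N%:R.
(* By [disc_chart0], the chart lands in the set wherever [d] is nonzero. *)
pose d : {mpoly R[6]} := 'X_2 * 'X_1 * 'X_5.
have ev i (p : {mpoly R[3 * 3]}) (u : 'I_6 -> R) :
    (mmap (@mpolyC 6 R) (fun j : 'I_6 => if (j < i)%N then 0 else 'X_j)
      (mmap (@mpolyC 6 R) (chart_poly 0) p)).@[u] =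
    p.@[fun j => mxvec (chart 0 (fun j => if (j < i)%N then 0 else u j)) 0 j].
  rewrite !meval_mmap; apply: meval_eq => j; rewrite meval_chart_poly.
  congr (mxvec (chart 0 _) 0 j); apply/funext => l.
  by case: ifP; rewrite ?meval0 ?mevalXU.
(* These values are triangular: with the coordinates before [i] set to 0, the [i]-th is still a
   nonzero polynomial, and it vanishes once [u i] is 0 as well. *)
have flagE i (u : 'I_6 -> R) : (flag i).@[fun j => mxvec (chart 0 u) 0 j] =
  nth 0 [:: 2 * (u 2 * u 0); 2 * (u 2 * (u 0 ^+ 2 + u 1 ^+ 2)); 2 * u 2;
            2 * (u 3 * u 5); 2 * (u 4 * u 5); 2 * u 5] i.
  have c0 : chart 0 u = chart0 u by apply/matrixP => a b; rewrite mxE !addr0.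
  have sE a b : (sym generic a b).@[fun j => mxvec (chart 0 u) 0 j] = sym (chart0 u) a b.
    by rewrite -sym_map meval_generic mxvecK c0.
  have aE a : (axial generic a).@[fun j => mxvec (chart 0 u) 0 j] = axial (chart0 u) a.
    by rewrite -axial_map meval_generic mxvecK c0.
  case: i => [[|[|[|[|[|[|//]]]]]] i6]; rewrite /flag /= ?sE ?aE /axial ?ord3E !mxE /=;
    ring.
apply: (@exists_prime_chain R _ _ (chart_poly 0) jac0_disc_gt0 d flag).
- by rewrite /d !mulf_neq0 // -msize_poly_eq0 msizeX.
- move=> u; rewrite /d !rmorphM /= !mevalXU => u0.
  rewrite (_ : \row_j _ = mxvec (chart 0 u)); last first.
    by apply/rowP => j; rewrite mxE meval_chart_poly.
  rewrite /jac0_disc_gt0 /= mxvecK /chart; split=> [i|].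
    by rewrite jac_shift jac_chart0.
  rewrite disc_shift disc_chart0 mulr_gt0 //.
    by rewrite exprn_even_gt0 //= -!mulrA mulf_neq0 ?pnatr_eq0 // !mulrA.
  by rewrite exprn_gt0 // ltr_wpDl ?addr_ge0 ?sqr_ge0.
(* Nonvanishing is tested at the point with all coordinates 1. *)
- move=> i; apply/negP => /eqP /(congr1 (meval (fun=> 1))).
  rewrite meval0 ev flagE => /eqP; apply/negP.
  case: i => [[|[|[|[|[|[|//]]]]]] i6] /=;
    by rewrite ?(mulr1, expr1n, expr0n, add0r) ?(pnatr_eq0, natrD) //=.
- move=> i; apply/mpoly_eq0 => u; rewrite ev flagE.
  by case: i => [[|[|[|[|[|[|//]]]]]] i6] /=;
    rewrite ?(mulr0, mul0r, expr0n, addr0).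
Qed.

Lemma semialgebraic_dim_jac0_disc_gt0 : semialgebraic_dim jac0_disc_gt0 6.
Proof.
by split; [exact: semialgebraic_jac0_disc_gt0 | exact: dim_jac0_disc_gt0].
Qed.

End Dimension.

(** * Orbits *)

Section Frames.
Variable T : comNzRingType.
Implicit Type g : 'M[T]_3.

Definition cross01 g (i : 'I_3) : T :=
  g (i + 1) 0 * g (i + 2) 1 - g (i + 2) 0 * g (i + 1) 1.

Lemma det3 g : \det g = \sum_i cross01 g i * g i 2.
Proof.
have det2 (A : 'M[T]_2) : \det A = A 0 0 * A 1 1 - A 0 1 * A 1 0.
  rewrite (expand_det_row _ 0) !big_ord_recl big_ord0 /cofactor !det_mx11 !mxE /=.
  have -> : lift 0 0 = 1 :> 'I_2 by exact/val_inj.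
  have -> : lift 1 0 = 0 :> 'I_2 by exact/val_inj.
  by rewrite expr0 expr1; ring.
have lE : (lift 0 0 = 1 :> 'I_3) * (lift 0 1 = 2 :> 'I_3) *
    (lift 1 0 = 0 :> 'I_3) * (lift 1 1 = 2 :> 'I_3) *
    (lift 2 0 = 0 :> 'I_3) * (lift 2 1 = 1 :> 'I_3).
  by do !split; exact/val_inj.
rewrite (expand_det_col _ 2) !sum_ord3 /cofactor !det2 !mxE !lE /=.
by rewrite /cross01 !ord3E; ring.
Qed.

(** One family for all the listed types: twice the diagonal matrix of [k], [e], 0 as [sym], and
    [(0, 0, 2 h)] as [axial]. *)
Definition nf (k h e : T) : 'M[T]_3 :=
  \matrix_(i, j) nth 0 (nth [::] [::
    [:: k; h; 0];
    [:: - h; e; 0];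
    [:: 0; 0; 0]] i) j.

Lemma nf_conj g k h e i j : (g *m nf k h e *m g^T) i j =
  k * (g i 0 * g j 0) + e * (g i 1 * g j 1) +
  h * (g i 0 * g j 1 - g i 1 * g j 0).
Proof. by rewrite mxE !sum_ord3 !mxE !sum_ord3 !mxE /=; ring. Qed.

(** Splits off a rank-one square from the quadratic form. If [cof s] is a multiple of [v v^T], the
    remainder is the same multiple of [b b^T] with [b = v x w]. *)
Lemma complete_square (s : 'M[T]_3) (w : 'I_3 -> T) i j :
  (forall i j, s i j = s j i) ->
  (\sum_k \sum_l s k l * w k * w l) * s i j =
  (\sum_k s i k * w k) * (\sum_k s j k * w k) +
  (cof s (i + 1) (j + 1) * w (i + 2) * w (j + 2)
   - cof s (i + 1) (j + 2) * w (i + 2) * w (j + 1)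
   - cof s (i + 2) (j + 1) * w (i + 1) * w (j + 2)
   + cof s (i + 2) (j + 2) * w (i + 1) * w (j + 1)).
Proof.
move=> sC; elim/forall_ord3: i; elim/forall_ord3: j; rewrite /cof !ord3E !sum_ord3;
  rewrite (sC 1 0) (sC 2 0) (sC 2 1); ring.
Qed.

End Frames.

(** * Adapted frames over the reals *)

Section FrameExistence.
Variable R : realType.

(** Polarization: the values of the form at the basis vectors and their pairwise sums determine
    [s]. *)
Lemma sym_nonisotropic (s : 'M[R]_3) : (forall i j, s i j = s j i) -> s != 0 ->
  exists w : 'I_3 -> R, \sum_k \sum_l s k l * w k * w l != 0.
Proof.
move=> sC; apply: contra_neqP => noniso.
have iso3 (a b c : R) : \sum_k \sum_l s k l * nth 0 [:: a; b; c] k * nth 0 [:: a; b; c] l = 0.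
  apply/eqP; apply: contra_notT noniso => ?.
  by exists (fun i : 'I_3 => nth 0 [:: a; b; c] i).
move: (iso3 1 0 0) (iso3 0 1 0) (iso3 0 0 1) (iso3 1 1 0) (iso3 1 0 1) (iso3 0 1 1).
rewrite !sum_ord3 /= (sC 1 0) (sC 2 0) (sC 2 1) => i1 i2 i3 i4 i5 i6.
by apply/matrixP; apply: forall_ord3; apply: forall_ord3; rewrite mxE;
  rewrite ?(sC 1 0) ?(sC 2 0) ?(sC 2 1); lra.
Qed.

Lemma exists_orthogonal (a : 'I_3 -> R) :
  exists2 v : 'I_3 -> R, exists i, v i != 0 & \sum_i a i * v i = 0.
Proof.
have [a0|a0] := eqVneq (a 0) 0; last first.
  exists (fun i => nth 0 [:: - a 1; a 0; 0] i); first by exists 1.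
  by rewrite sum_ord3 /=; ring.
exists (fun i => nth 0 [:: 1; 0; 0] i); first by exists 0; rewrite oner_eq0.
by rewrite sum_ord3 /= a0; ring.
Qed.

(* With [q = w^T s w], the frame is [(s w, (v x w) / h, h v / |v|^2)], up to the
   factors 2 due to [sym] and [axial]; its determinant is [q]. *)
Lemma exists_frame (s : 'M[R]_3) (v : 'I_3 -> R) (h e : R) :
  (forall i j, s i j = s j i) -> s != 0 -> (exists i, v i != 0) -> h != 0 ->
  (forall i, \sum_j s i j * v j = 0) ->
  (forall i j, h ^+ 2 * cof s i j = e * (v i * v j)) ->
  exists2 g, g \in unitmx &
    (forall i j, s i j = 2 / \det g * (g i 0 * g j 0 + e * (g i 1 * g j 1))) /\
    (forall i, v i = 2 * h / \det g * cross01 g i).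
Proof.
move=> sC /(sym_nonisotropic sC)[w q0] [i0 vi0] h0 sv cofs.
set q := \sum_k _ in q0.
pose a i := \sum_j s i j * w j.
pose b i := v (i + 1) * w (i + 2) - v (i + 2) * w (i + 1).
pose n := \sum_i v i ^+ 2.
have n0 : n != 0.
  rewrite gt_eqF // /n (bigD1 i0) //= ltr_pwDl ?sumr_ge0 //.
    by rewrite exprn_even_gt0.
  by move=> i _; rewrite sqr_ge0.
pose g : 'M[R]_3 := \matrix_(i, j)
  nth 0 [:: a i / 2; b i / (2 * h); 2 * h * v i / n] j.
have ga i : g i 0 = a i / 2 by rewrite mxE.
have gb i : g i 1 = b i / (2 * h) by rewrite mxE.
have gv i : g i 2 = 2 * h * v i / n by rewrite mxE.
have av : \sum_i a i * v i = 0.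
  transitivity (\sum_j w j * \sum_i s j i * v i); last first.
    by apply: big1 => j _; rewrite sv mulr0.
  by rewrite /a !sum_ord3 (sC 1 0) (sC 2 0) (sC 2 1); ring.
have aw : \sum_i a i * w i = q.
  by rewrite /q /a !sum_ord3; ring.
(* The triple product [a x (v x w) = (a.w) v - (a.v) w], where [a.v = 0] and [a.w = q]. *)
have crossE i : cross01 g i = q * v i / (4 * h).
  rewrite /cross01 !ga !gb -[q * _]addr0 -(mulr0 (- w i)) -av -aw !sum_ord3 /b.
  by elim/forall_ord3: i; rewrite !ord3E; field.
have detE : \det g = q / 2.
  rewrite det3 (eq_bigr (fun i => q / (2 * n) * v i ^+ 2)).
    by rewrite -mulr_sumr -/n; field.
  by move=> i _; rewrite crossE gv; field; rewrite n0 h0.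
have det0 : \det g != 0 by rewrite detE mulf_neq0 ?invr_eq0 ?pnatr_eq0.
exists g; first by rewrite unitmxE unitfE.
split=> [i j|i]; rewrite detE; last by rewrite crossE; field; rewrite h0 q0.
rewrite !ga !gb; apply: (mulfI q0); rewrite complete_square // -/(a i) -/(a j).
have cE k l : cof s k l = e * (v k * v l) / h ^+ 2.
  by rewrite -cofs mulrAC divff ?mul1r // expf_neq0.
by rewrite !cE /b; field; rewrite h0 q0.
Qed.

End FrameExistence.

(** * The action in coordinates and the equations of the orbits *)

Section Orbits.
Variable R : realType.
Local Notation orbit := (@Defs.orbit R).
Implicit Types c g : 'M[R]_3.

(** In this coding the bracket is [c] applied to the cross product, and
    [g^T (g x x g y) = det g (x x y)]. *)
Lemma actE g c : g \in unitmx -> act g c = (\det g)^-1 *: (g *m c *m g^T).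
Proof.
move=> gU; have det0 : \det g != 0 by rewrite -unitfE -unitmxE.
pose cross (a b : 'cV[R]_3) : 'cV[R]_3 :=
  \col_i (a (i + 1) 0 * b (i + 2) 0 - a (i + 2) 0 * b (i + 1) 0).
have bracket_cross c' a b : bracket c' a b = c' *m cross a b.
  by apply/colP => i; rewrite !mxE sum_ord3 !mxE !ord3E; ring.
rewrite -[RHS]bracketK /act; congr brackets_of_map.
apply/funext => a; apply/funext => b; rewrite !bracket_cross.
rewrite -scalemxAl -!mulmxA !scalemxAr; congr (_ *m (_ *m _)).
rewrite -{2}(mulKVmx gU a) -{2}(mulKVmx gU b).
move: (invmx g *m a) (invmx g *m b) => x y.
apply: (scalerI det0); rewrite -scalemxAr scalerA divff // scale1r.
apply/colP; apply: forall_ord3;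
  rewrite !mxE !sum_ord3 !mxE !ord3E !sum_ord3 det3 !sum_ord3 /cross01 !ord3E; ring.
Qed.

Lemma act_mul g g' c : g \in unitmx -> g' \in unitmx ->
  act g (act g' c) = act (g *m g') c.
Proof.
move=> gU gU'; rewrite !actE ?unitmx_mul ?gU //.
rewrite det_mulmx invfM trmx_mul -scalerA; congr (_ *: _).
by rewrite -scalemxAr -scalemxAl !mulmxA.
Qed.

Lemma act_linear g (k : R) c d : g \in unitmx ->
  act g (c + k *: d) = act g c + k *: act g d.
Proof.
move=> gU; rewrite !actE // mulmxDr mulmxDl scalerDr -scalemxAr -scalemxAl.
by rewrite !scalerA (mulrC k).
Qed.

Lemma orbit_refl c : orbit c c.
Proof.
exists 1%:M; first exact: unitmx1.
by rewrite actE ?unitmx1 // det1 invr1 scale1r mul1mx trmx1 mulmx1.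
Qed.

Lemma orbit_act g c : g \in unitmx -> orbit (act g c) `<=` orbit c.
Proof.
move=> gU _ [g' gU' <-]; exists (g' *m g); last by rewrite act_mul.
by rewrite /= unitmx_mul gU'.
Qed.

Lemma orbit_eq c d : orbit c d -> orbit d = orbit c.
Proof.
move=> [g gU <-]; apply/seteqP; split; first exact: orbit_act.
have cE : c = act (invmx g) (act g c).
  rewrite act_mul ?unitmx_inv // mulVmx // actE ?unitmx1 //.
  by rewrite det1 invr1 scale1r mul1mx trmx1 mulmx1.
by rewrite {1}cE; apply: orbit_act; rewrite unitmx_inv.
Qed.

Lemma orbit_actl g c d : g \in unitmx -> orbit c d -> orbit c (act g d).
Proof.
by move=> gU cd; rewrite -(orbit_eq cd); exists g.
Qed.

Lemma eq_sym_axial c d :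
  (forall i j, sym c i j = sym d i j) -> (forall i, axial c i = axial d i) -> c = d.
Proof.
move=> sE aE; have inj2 (x y : R) : x *+ 2 = y *+ 2 -> x = y.
  by move=> /eqP; rewrite eqrMn2r // => /eqP.
have [c00 c12 c21] := mxE_sym_axial c 0; have [c11 c20 c02] := mxE_sym_axial c 1.
have [c22 c01 c10] := mxE_sym_axial c 2.
have [d00 d12 d21] := mxE_sym_axial d 0; have [d11 d20 d02] := mxE_sym_axial d 1.
have [d22 d01 d10] := mxE_sym_axial d 2.
move: c00 c12 c21 c11 c20 c02 c22 c01 c10 d00 d12 d21 d11 d20 d02 d22 d01 d10.
rewrite !ord3E !sE !aE => c00 c12 c21 c11 c20 c02 c22 c01 c10.
move=> d00 d12 d21 d11 d20 d02 d22 d01 d10.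
by apply/matrixP; apply: forall_ord3; apply: forall_ord3; apply: inj2;
  rewrite ?(c00, c12, c21, c11, c20, c02, c22, c01, c10)
    ?(d00, d12, d21, d11, d20, d02, d22, d01, d10).
Qed.

Lemma symE c i j : sym c i j = c i j + c j i.
Proof. by rewrite !mxE. Qed.

Lemma act_nf g k h e i j : g \in unitmx ->
  act g (nf k h e) i j = (\det g)^-1 * (k * (g i 0 * g j 0) +
    e * (g i 1 * g j 1) + h * (g i 0 * g j 1 - g i 1 * g j 0)).
Proof. by move=> gU; rewrite actE // -nf_conj mxE. Qed.

Lemma sym_act_nf g k h e i j : g \in unitmx ->
  sym (act g (nf k h e)) i j =
  2 / \det g * (k * (g i 0 * g j 0) + e * (g i 1 * g j 1)).
Proof.
by move=> gU; rewrite symE !act_nf //; ring.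
Qed.

Lemma axial_act_nf g k h e i : g \in unitmx ->
  axial (act g (nf k h e)) i = 2 * h / \det g * cross01 g i.
Proof.
by move=> gU; rewrite /axial /cross01 !act_nf //; ring.
Qed.

Lemma X_nf (k h e : R) : X R (nf k h e).
Proof.
move=> x y z; apply/colP; apply: forall_ord3; rewrite !mxE /=; ring.
Qed.

Section OrbitOfNf.
Variables (k h e : R) (c : 'M[R]_3).
Hypothesis orb_c : orbit (nf k h e) c.

Lemma jac_orbit_nf i : jac c i = 0.
Proof.
have [g gU <-] := orb_c.
rewrite /jac (eq_bigr _ (fun j _ => congr2 *%R (sym_act_nf k h e i j gU)
  (axial_act_nf k h e j gU))).
by rewrite sum_ord3 /cross01 !ord3E; ring.
Qed.

(** Both [cof (sym c) i j] and the product of axial coordinates are multiples of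
    [cross01 g i * cross01 g j]. *)
Lemma cof_orbit_nf i j :
  h ^+ 2 * cof (sym c) i j = k * e * (axial c i * axial c j).
Proof.
have [g gU <-] := orb_c.
by rewrite /cof !sym_act_nf // !axial_act_nf // /cross01; ring.
Qed.

Lemma axial_orbit_nf : h != 0 -> exists i, axial c i != 0.
Proof.
have [g gU <-] := orb_c; move=> h0; apply: contrapT => ax0.
have det0 : \det g != 0 by rewrite -unitfE -unitmxE.
case/negP: det0; rewrite det3; apply/eqP/big1 => i _.
suff -> : cross01 g i = 0 by rewrite mul0r.
have /eqP : axial (act g (nf k h e)) i = 0.
  by apply/eqP; apply: contra_notT ax0 => ?; exists i.
rewrite axial_act_nf // !mulf_eq0 invr_eq0 pnatr_eq0 (negPf h0) /=.
by move: gU; rewrite /= unitmxE unitfE => /negPf -> /= /eqP.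
Qed.

End OrbitOfNf.

(** Converse of [jac_orbit_nf] and [cof_orbit_nf]: the frame of [exists_frame] is the required group
    element. *)
Lemma orbit_nf1P c h e : h != 0 ->
  (exists i, axial c i != 0) -> sym c != 0 -> (forall i, jac c i = 0) ->
  (forall i j, h ^+ 2 * cof (sym c) i j = e * (axial c i * axial c j)) ->
  orbit (nf 1 h e) c.
Proof.
move=> h0 ax s0 jac0 cofs.
have [g gU [sE aE]] := exists_frame (symC c) s0 ax h0 jac0 cofs.
exists g => //; apply: eq_sym_axial => [i j|i].
  by rewrite sym_act_nf // mul1r -sE.
by rewrite axial_act_nf // -aE.
Qed.

(** Only the axial part must be matched, so [exists_frame] is applied to the auxiliary rank-one form
    [w w^T] with [w] orthogonal to [axial c]. *)
Lemma orbit_nf010P c : (exists i, axial c i != 0) -> sym c = 0 ->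
  orbit (nf 0 1 0) c.
Proof.
move=> ax s0; have [w [i0 wi0] wv] := exists_orthogonal (axial c).
pose s : 'M[R]_3 := \matrix_(i, j) (w i * w j).
have [||||||g gU [_ aE]] := @exists_frame R s (axial c) 1 0.
- by move=> i j; rewrite !mxE mulrC.
- apply: contra_neq wi0 => /matrixP/(_ i0 i0); rewrite !mxE => /eqP.
  by rewrite mulf_eq0 orbb => /eqP.
- exact: ax.
- exact: oner_neq0.
- move=> i; transitivity (w i * \sum_j axial c j * w j).
    by rewrite mulr_sumr; apply: eq_bigr => j _; rewrite mxE; ring.
  by rewrite wv mulr0.
- by move=> i j; rewrite /cof !mxE; ring.
exists g => //; apply: eq_sym_axial => [i j|i].
  by rewrite sym_act_nf // s0 mxE; ring.
by rewrite axial_act_nf // -aE.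
Qed.

(** Dually, only the symmetric part must be matched, and an auxiliary [v] orthogonal to [a = S w]
    serves as axial vector. It satisfies [S v = 0], because vanishing cofactors give
    [q S = a a^T]. *)
Lemma orbit_nf100P c : (forall i, axial c i = 0) -> sym c != 0 ->
  (forall i j, cof (sym c) i j = 0) -> orbit (nf 1 0 0) c.
Proof.
move=> ax0 s0 cof0; have [w q0] := sym_nonisotropic (symC c) s0.
pose a i := \sum_j sym c i j * w j.
have [v v0 av] := exists_orthogonal a.
have [||g gU [sE _]] := exists_frame (symC c) s0 v0 (oner_neq0 R) (e := 0).
- move=> i; apply: (mulfI q0); rewrite mulr0 mulr_sumr.
  transitivity (a i * \sum_j a j * v j); last by rewrite av mulr0.
  rewrite mulr_sumr; apply: eq_bigr => j _.
  by rewrite [LHS]mulrA (complete_square w i j (symC c)) !cof0 -/(a i) -/(a j); ring.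
- by move=> i j; rewrite cof0; ring.
exists g => //; apply: eq_sym_axial => [i j|i].
  by rewrite sym_act_nf // mul1r -sE.
by rewrite axial_act_nf // ax0; ring.
Qed.

Lemma orbit_nf000P c : (forall i, axial c i = 0) -> sym c = 0 -> orbit (nf 0 0 0) c.
Proof.
move=> ax0 s0; exists 1%:M; first exact: unitmx1.
by apply: eq_sym_axial => [i j|i];
  rewrite (sym_act_nf, axial_act_nf) ?unitmx1 // ?ax0 ?s0 ?mxE; ring.
Qed.

Lemma brackets_nf (k h e : R) :
  brackets (k *: e1 R - h *: e2 R) (h *: e1 R + e *: e2 R) 0 = nf k h e.
Proof.
by apply/matrixP; apply: forall_ord3; apply: forall_ord3;
  rewrite !mxE /= ?mxE /=; ring.
Qed.

Lemma B_IE : B_I R = orbit (nf 0 0 0).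
Proof. by rewrite -brackets_nf ?(scale0r, scale1r, scaleN1r, oppr0, add0r, addr0). Qed.

Lemma B_IIE : B_II R = orbit (nf 1 0 0).
Proof. by rewrite -brackets_nf ?(scale0r, scale1r, scaleN1r, oppr0, add0r, addr0). Qed.

Lemma B_IVE : B_IV R = orbit (nf 1 1 0).
Proof. by rewrite -brackets_nf ?(scale0r, scale1r, scaleN1r, oppr0, add0r, addr0). Qed.

Lemma B_VE : B_V R = orbit (nf 0 1 0).
Proof. by rewrite -brackets_nf ?(scale0r, scale1r, scaleN1r, oppr0, add0r, addr0). Qed.

Lemma B_VIE (h : R) : B_VI h = orbit (nf 1 h (-1)).
Proof. by rewrite -brackets_nf ?(scale0r, scale1r, scaleN1r, oppr0, add0r, addr0). Qed.

Lemma B_VIIE (h : R) : B_VII h = orbit (nf 1 h 1).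
Proof. by rewrite -brackets_nf ?(scale0r, scale1r, scaleN1r, oppr0, add0r, addr0). Qed.

End Orbits.

End BracketAlgebra.

From mathcomp Require Import all_classical all_reals all_analysis ring.
Import Order.TTheory GRing.Theory Num.Theory.
Import numFieldNormedType.Exports.
Import BracketAlgebra.
Local Open Scope classical_set_scope.
Local Open Scope ring_scope.

(** * Closures of orbits *)

Section Closures.
Variable R : realType.
Implicit Types (U : set 'M[R]_3) (c d : 'M[R]_3).
Local Notation orbit := (@Defs.orbit R).

(** The quadratic term serves degenerations such as [nf 1 1 (t^2 e)], whose parameter [t^-1] needs
    no square root. *)
Lemma closure_path U c d d' :
  (forall t, 0 < t -> U (c + t *: d + t ^+ 2 *: d')) -> closure U c.
Proof.
move=> path B Bc.
have cvg0 : c + t *: d + t ^+ 2 *: d' @[t --> (0 : R)] --> c.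
  rewrite [X in _ --> X](_ : _ = c + 0 *: d + 0 ^+ 2 *: d'); last first.
    by rewrite expr0n !scale0r !addr0.
  apply: cvgD; last by apply: cvgZ; [exact: exprn_continuous | exact: cvg_cst].
  by apply: cvgD; [exact: cvg_cst | apply: cvgZ; [exact: cvg_id | exact: cvg_cst]].
have near0 : \forall t \near (0 : R)^'+, B (c + t *: d + t ^+ 2 *: d').
  exact: (cvg_at_right_filter cvg0).
have [t [t0 Bt]] := filter_ex (filterI (nbhs_right_gt (0 : R)) near0).
by exists (c + t *: d + t ^+ 2 *: d'); split => //; exact: path.
Qed.

Lemma closure_eq0 U (f : 'M[R]_3 -> R) c :
  continuous f -> (forall x, U x -> f x = 0) -> closure U c -> f c = 0.
Proof.
move=> fc f0 Uc; have : closure (f @^-1` [set x | x = 0]) c.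
  by apply: closure_subset Uc => x /f0.
by rewrite -(closure_id _).1 //; apply: closed_comp => // x _; exact: fc.
Qed.

Lemma continuous_add (T : topologicalType) (f g : T -> R) :
  continuous f -> continuous g -> continuous (fun x => f x + g x).
Proof. by move=> fc gc x; exact: cvgD (fc x) (gc x). Qed.

Lemma continuous_sub (T : topologicalType) (f g : T -> R) :
  continuous f -> continuous g -> continuous (fun x => f x - g x).
Proof. by move=> fc gc x; exact: cvgB (fc x) (gc x). Qed.

Lemma continuous_mul (T : topologicalType) (f g : T -> R) :
  continuous f -> continuous g -> continuous (fun x => f x * g x).
Proof. by move=> fc gc x; exact: cvgM (fc x) (gc x). Qed.

Lemma continuous_cstl (T : topologicalType) (k : R) (f : T -> R) :
  continuous f -> continuous (fun x => k * f x).
Proof. by apply: (@continuous_mul T (fun=> k)) => x; exact: cvg_cst. Qed.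

Lemma continuous_entry i j : continuous (fun c => c i j).
Proof. exact: coord_continuous. Qed.

Lemma continuous_sym i j : continuous (fun c => sym c i j).
Proof.
rewrite (_ : (fun c => _) = (fun c => c i j + c j i)).
  by apply: continuous_add; exact: continuous_entry.
by apply/funext => c; rewrite symE.
Qed.

Lemma continuous_axial i : continuous (fun c => axial c i).
Proof. by rewrite /axial; apply: continuous_sub; exact: continuous_entry. Qed.

Lemma continuous_cof i j : continuous (fun c => cof (sym c) i j).
Proof.
by rewrite /cof; apply: continuous_sub; apply: continuous_mul; exact: continuous_sym.
Qed.

Lemma continuous_jac i : continuous (fun c => jac c i).
Proof.
have -> : (fun c => jac c i) = (fun c => sym c i 0 * axial c 0 +
    sym c i 1 * axial c 1 + sym c i 2 * axial c 2).
  by apply/funext => c; rewrite /jac sum_ord3.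
apply: continuous_add; first apply: continuous_add.
all: by apply: continuous_mul; [exact: continuous_sym | exact: continuous_axial].
Qed.

Lemma closure_orbit_nf k h e c : closure (orbit (nf k h e)) c ->
  (forall i, jac c i = 0) /\
  (forall i j, h ^+ 2 * cof (sym c) i j = k * e * (axial c i * axial c j)).
Proof.
move=> cl; split=> [i|i j].
  by apply: closure_eq0 (continuous_jac i) _ cl => x /jac_orbit_nf.
apply/eqP; rewrite -subr_eq0; apply/eqP.
apply: (@closure_eq0 _ (fun c => h ^+ 2 * cof (sym c) i j -
  k * e * (axial c i * axial c j)) _ _ _ cl).
  apply: continuous_sub; apply: continuous_cstl; first exact: continuous_cof.
  by apply: continuous_mul; exact: continuous_axial.
by move=> x /cof_orbit_nf ->; rewrite subrr.
Qed.

Lemma sym_closure_orbit_nf010 c : closure (orbit (nf 0 1 0)) c -> sym c = 0.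
Proof.
move=> cl; apply/matrixP => i j; rewrite [RHS]mxE.
apply: closure_eq0 (continuous_sym i j) _ cl => x [g gU <-].
by rewrite sym_act_nf // !mul0r addr0 mulr0.
Qed.

Lemma nfD k h e k' h' e' e'' (t : R) :
  nf (k + t * k') (h + t * h') (e + t * e' + t ^+ 2 * e'') =
  nf k h e + t *: nf k' h' e' + t ^+ 2 *: nf 0 0 e''.
Proof.
by apply/matrixP; apply: forall_ord3; apply: forall_ord3; rewrite !mxE /=; ring.
Qed.

(** The action is linear, so a path through the normal form is carried to a path of the same shape
    through any point of its orbit. *)
Lemma orbit_nf_sub_closure U k h e k' h' e' e'' :
  (forall g c, g \in unitmx -> U c -> U (act g c)) ->
  (forall t, 0 < t -> U (nf (k + t * k') (h + t * h') (e + t * e' + t ^+ 2 * e''))) ->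
  orbit (nf k h e) `<=` closure U.
Proof.
move=> Uact path _ [g gU <-].
apply: (@closure_path _ _ (act g (nf k' h' e')) (act g (nf 0 0 e''))) => t t0.
by rewrite -!act_linear // -nfD; apply: Uact => //; exact: path.
Qed.

(** For [k] and [h] nonzero, [k e / h^2] is the only invariant of the orbit; in particular the sign
    of [h] does not matter. *)
Lemma orbit_nf_nf k h e h' e' : k != 0 -> h != 0 -> h' != 0 ->
  h' ^+ 2 * (k * e) = e' * h ^+ 2 -> orbit (nf 1 h' e') (nf k h e).
Proof.
move=> k0 h0 h'0 E; have nn := orbit_refl (nf k h e).
apply: orbit_nf1P => //.
- exact: axial_orbit_nf nn h0.
- apply: contra_neq k0 => /matrixP/(_ 0 0); rewrite !mxE /= => /eqP.
  by rewrite -mulr2n mulrn_eq0 => /eqP.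
- exact: jac_orbit_nf nn.
- move=> i j; apply: (mulfI (expf_neq0 2 h0)).
  by rewrite mulrCA (cof_orbit_nf nn) !mulrA -(mulrA _ k) E; ring.
Qed.

Lemma orbits_inP (S : set 'M[R]_3) (O : set 'M[R]_3) : orbits_in S O ->
  exists c, [/\ X R c, O = orbit c & S c].
Proof.
move=> [[c Xc ->] sub]; exists c; split=> //; apply: sub; exact: orbit_refl.
Qed.

Lemma orbits_in_nf S k h e : orbit (nf k h e) `<=` S ->
  orbits_in S (orbit (nf k h e)).
Proof. by split=> //; exists (nf k h e) => //; exact: X_nf. Qed.

Lemma axial_eq0 c : ~ (exists i, axial c i != 0) -> forall i, axial c i = 0.
Proof. by move=> ax i; apply/eqP; apply: contra_notT ax => ?; exists i. Qed.

Lemma orbits_in_closure_V :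
  orbits_in (closure (B_V R)) = [set B_V R; B_I R].
Proof.
rewrite B_VE B_IE; apply/seteqP; split=> O.
  move=> /orbits_inP[c [_ -> /sym_closure_orbit_nf010 s0]].
  have [ax|/axial_eq0 ax] := pselect (exists i, axial c i != 0).
    by left; exact/orbit_eq/orbit_nf010P.
  by right; exact/orbit_eq/orbit_nf000P.
case=> ->; apply: orbits_in_nf; first exact: subset_closure.
apply: (@orbit_nf_sub_closure _ _ _ _ 0 1 0 0) => [g c|t t0]; first exact: orbit_actl.
apply: orbit_nf010P; first by apply: axial_orbit_nf (orbit_refl _) _; rewrite add0r mulr1 gt_eqF.
apply/matrixP; apply: forall_ord3; apply: forall_ord3; rewrite !mxE /=; ring.
Qed.

(** On the closure all cofactors vanish; which of [S] and [v] are zero then selects one of the four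
    orbits. Each is approached by [nf k h 0] with [k] and [h] nonzero. *)
Lemma orbits_in_closure_IV : orbits_in (closure (B_IV R)) =
  [set B_IV R; B_II R; B_V R; B_I R].
Proof.
rewrite B_IVE B_IIE B_VE B_IE; apply/seteqP; split=> O.
  move=> /orbits_inP[c [_ -> /closure_orbit_nf[jac0]]].
  rewrite mulr0 expr1n => cof0.
  have {}cof0 i j : cof (sym c) i j = 0 by rewrite -[LHS]mul1r cof0 mul0r.
  have [s0|s0] := eqVneq (sym c) 0;
      have [ax|/axial_eq0 ax] := pselect (exists i, axial c i != 0).
  - by left; right; exact/orbit_eq/orbit_nf010P.
  - by right; exact/orbit_eq/orbit_nf000P.
  - left; left; left; apply/orbit_eq/orbit_nf1P => // i j.
    by rewrite cof0 mulr0 mul0r.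
  - by left; left; right; exact/orbit_eq/orbit_nf100P.
have in_IV (k h : R) : k != 0 -> h != 0 -> orbit (nf 1 1 0) (nf k h 0).
  by move=> k0 h0; apply: orbit_nf_nf => //; rewrite ?oner_neq0 // !mulr0 mul0r.
have sub k h k' h' : (forall t, 0 < t -> k + t * k' != 0 /\ h + t * h' != 0) ->
    orbit (nf k h 0) `<=` closure (orbit (nf 1 1 0)).
  move=> kh; apply: (@orbit_nf_sub_closure _ _ _ _ k' h' 0 0) => [g c|t /kh[]].
    exact: orbit_actl.
  by rewrite !mulr0 !addr0; exact: in_IV.
case=> [[[]|]|] ->; apply: orbits_in_nf; first exact: subset_closure.
- by apply: (sub _ _ 0 1) => t t0; rewrite mulr0 mulr1 addr0 add0r oner_neq0 gt_eqF.
- by apply: (sub _ _ 1 0) => t t0; rewrite mulr0 mulr1 addr0 add0r oner_neq0 gt_eqF.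
- by apply: (sub _ _ 1 1) => t t0; rewrite mulr1 add0r gt_eqF.
Qed.

(** Treats VI and VII at once. As [e != 0], the equation gives [cof S != 0] wherever [v != 0], so
    boundary points have [v = 0] and [S] of rank at most one. *)
Lemma orbits_in_closure_nf (h e : R) : h != 0 -> e != 0 ->
  orbits_in (closure (orbit (nf 1 h e))) =
  [set orbit (nf 1 h e); B_II R; B_I R].
Proof.
move=> h0 e0; rewrite B_IIE B_IE; apply/seteqP; split=> O.
  move=> /orbits_inP[c [_ -> /closure_orbit_nf[jac0]]].
  rewrite mul1r => cofs.
  have [ax|/axial_eq0 ax] := pselect (exists i, axial c i != 0).
    left; left; apply/orbit_eq/orbit_nf1P => //.
    have [i ai] := ax; apply: contra_neq ai => s0; apply/eqP.
    have /eqP := cofs i i; rewrite s0 /cof !mxE !mulr0 subrr mulr0 eq_sym.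
    by rewrite !mulf_eq0 (negPf e0) orbb.
  have cof0 i j : cof (sym c) i j = 0.
    by apply: (mulfI (expf_neq0 2 h0)); rewrite cofs !ax !mulr0.
  have [s0|s0] := eqVneq (sym c) 0.
    by right; exact/orbit_eq/orbit_nf000P.
  by left; right; exact/orbit_eq/orbit_nf100P.
case=> [[]|] ->; apply: orbits_in_nf; first exact: subset_closure.
- apply: (@orbit_nf_sub_closure _ _ _ _ 0 h 0 e) => [g c|t t0]; first exact: orbit_actl.
  apply: orbit_nf_nf => //; rewrite ?mulr0 ?addr0 ?add0r ?oner_neq0 //.
    by rewrite mulf_neq0 // gt_eqF.
  by ring.
- apply: (@orbit_nf_sub_closure _ _ _ _ 1 h e 0) => [g c|t t0]; first exact: orbit_actl.
  apply: orbit_nf_nf => //; rewrite ?mulr0 ?mulr1 ?addr0 ?add0r ?mulf_neq0 // ?gt_eqF //.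
  by ring.
Qed.

Lemma cof_nf (k h e : R) : cof (sym (nf k h e)) 2 2 = 4 * (k * e).
Proof. by rewrite /cof !ord3E !mxE /=; ring. Qed.

Lemma axial_nf (k h e : R) : axial (nf k h e) 2 = 2 * h.
Proof. by rewrite /axial !ord3E !mxE /=; ring. Qed.

(* The orbits for [h] and [-h] agree, so one of [h], [-h] in [P] suffices. *)
Lemma orbits_in_closure_union (P : set R) (e : R) : e != 0 ->
  (forall h, P h -> h != 0) -> (forall h, h != 0 -> P h \/ P (- h)) ->
  [set B_IV R; B_V R; orbit (nf 1 0 e)] `<=`
  orbits_in (closure (\bigcup_(h in P) orbit (nf 1 h e))) `\`
  \bigcup_(h in P) orbits_in (closure (orbit (nf 1 h e))).
Proof.
move=> e0 P0 PN; rewrite B_IVE B_VE.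
set U := \bigcup_(h in P) orbit (nf 1 h e).
have Uact g c : g \in unitmx -> U c -> U (act g c).
  by move=> gU [h Ph hc]; exists h => //; exact: orbit_actl.
have UE k h e' h' : k != 0 -> h != 0 -> h' != 0 ->
    h' ^+ 2 * (k * e') = e * h ^+ 2 -> U (nf k h e').
  move=> k0 h0 h'0 E; have [Ph|Ph] := PN _ h'0.
    by exists h' => //; exact: orbit_nf_nf.
  by exists (- h') => //; apply: orbit_nf_nf; rewrite ?oppr_eq0 ?sqrrN.
(* The equation of the closure fails at these normal forms, already in the entry [(2, 2)]. *)
have out k h' e' : (forall h, P h ->
      ~ forall i j, h ^+ 2 * cof (sym (nf k h' e')) i j =
        e * (axial (nf k h' e') i * axial (nf k h' e') j)) ->
    ~ (\bigcup_(h in P) orbits_in (closure (orbit (nf 1 h e)))) (orbit (nf k h' e')).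
  move=> cofN [h Ph [_ sub]]; apply: (cofN h Ph).
  by have [_] := @closure_orbit_nf _ _ _ _ (sub _ (orbit_refl _)); rewrite mul1r.
have e4 : e * (2 * 2) != 0 by rewrite mulf_neq0 // -natrM pnatr_eq0.
(* The paths are [nf 1 1 (t^2 e)], [nf t 1 (t e)] and [nf 1 t e]. The first two have parameter
   [t^-1], tending to infinity; the last has parameter [t]. *)
move=> O [[]|] ->; split.
- apply: orbits_in_nf; apply: (@orbit_nf_sub_closure _ _ _ _ 0 0 0 e) => // t t0.
  apply: (UE _ _ _ t^-1); rewrite ?mulr0 ?addr0 ?add0r ?invr_eq0 ?gt_eqF ?oner_neq0 //.
  by field; rewrite gt_eqF.
- apply: out => h Ph /(_ 2 2); rewrite cof_nf !axial_nf => /eqP.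
  by apply/negP; rewrite mulr1 !mulr0 eq_sym.
- apply: orbits_in_nf; apply: (@orbit_nf_sub_closure _ _ _ _ 1 0 e 0) => // t t0.
  apply: (UE _ _ _ t^-1); rewrite ?mulr0 ?mulr1 ?addr0 ?add0r ?invr_eq0 ?gt_eqF ?oner_neq0 //.
  by field; rewrite gt_eqF.
- apply: out => h Ph /(_ 2 2); rewrite cof_nf !axial_nf => /eqP.
  by apply/negP; rewrite mulr1 !mulr0 eq_sym.
- apply: orbits_in_nf; apply: (@orbit_nf_sub_closure _ _ _ _ 0 1 0 0) => // t t0.
  apply: (UE _ _ _ t); rewrite ?mulr0 ?mulr1 ?addr0 ?add0r ?gt_eqF ?oner_neq0 //.
  by ring.
- apply: out => h Ph /(_ 2 2); rewrite cof_nf !axial_nf => /eqP.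
  by apply/negP; rewrite !mulr0 mul1r mulf_neq0 ?expf_neq0 ?(P0 h) // mulf_neq0 // pnatr_eq0.
Qed.

(** Taking the trace of [h^2 cof S = v v^T] gives [h^2 tr (cof S) = |v|^2]. Conversely this recovers
    [h] as a square root, and [cofE] restores the full matrix equation. *)
Lemma VII_posE : \bigcup_(h in [set h : R | 0 < h]) B_VII h =
  [set c | (forall i, jac c i = 0) /\ 0 < disc c].
Proof.
apply/seteqP; split=> c.
  move=> [h /= h_gt0]; rewrite B_VIIE => hc; split; first exact: jac_orbit_nf hc.
  have [i0 ai0] := axial_orbit_nf hc (lt0r_neq0 h_gt0).
  have h2 : 0 < h ^+ 2 by rewrite exprn_gt0.
  have v_gt0 : 0 < \sum_i axial c i ^+ 2.
    rewrite (bigD1 i0) //= ltr_pwDl ?sumr_ge0 ?exprn_even_gt0 // => i _.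
    exact: sqr_ge0.
  rewrite /disc mulr_gt0 // -(pmulr_rgt0 _ h2) mulr_sumr.
  rewrite (eq_bigr (fun i => axial c i ^+ 2)) // => i _.
  by rewrite (cof_orbit_nf hc) !mul1r -expr2.
move=> [jac0 disc_gt0].
have v_ge0 : 0 <= \sum_i axial c i ^+ 2 by apply: sumr_ge0 => i _; exact: sqr_ge0.
have v_gt0 : 0 < \sum_i axial c i ^+ 2.
  by rewrite lt_def v_ge0 andbT; apply: contraTneq disc_gt0 => v0; rewrite /disc v0 mul0r ltxx.
have tr_gt0 : 0 < \sum_i cof (sym c) i i by move: disc_gt0; rewrite /disc pmulr_rgt0.
pose h := Num.sqrt ((\sum_i axial c i ^+ 2) / \sum_i cof (sym c) i i).
have h_gt0 : 0 < h by rewrite sqrtr_gt0 divr_gt0.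
exists h => //; rewrite B_VIIE; apply: orbit_nf1P => //.
- exact: lt0r_neq0.
- apply: contrapT => /axial_eq0 ax; move: v_gt0.
  by rewrite big1 ?ltxx // => i _; rewrite ax expr0n.
- apply: contraTneq tr_gt0 => s0.
  by rewrite big1 ?ltxx // => i _; rewrite /cof s0 !mxE mulr0 subrr.
- move=> i j; rewrite sqr_sqrtr ?divr_ge0 // 1?ltW // mulrAC cofE // mul1r -mulrA.
  by rewrite mulrAC divff ?mul1r // gt_eqF.
Qed.

Lemma semialgebraic_dim_VII_pos : semialgebraic_dim
  [set mxvec c | c in \bigcup_(h in [set h : R | 0 < h]) B_VII h] 6.
Proof.
rewrite VII_posE; suff -> : [set mxvec c | c in
    [set c : 'M[R]_3 | (forall i, jac c i = 0) /\ 0 < disc c]] = @jac0_disc_gt0 R.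
  exact: semialgebraic_dim_jac0_disc_gt0.
apply/seteqP; split=> [_ [c cP <-]|x xP]; first by rewrite /jac0_disc_gt0 /= mxvecK.
by exists (vec_mx x) => //; exact: vec_mxK.
Qed.

End Closures.

Theorem mainTheorem5 (R : realType) :
  let VI_neg : set 'M[R]_3 := \bigcup_(h in [set h : R | h < 0]) B_VI h in
  let VII_pos : set 'M[R]_3 := \bigcup_(h in [set h : R | 0 < h]) B_VII h in
  [/\ orbits_in (closure (B_V R)) = [set B_V R; B_I R],
      orbits_in (closure (B_IV R)) = [set B_IV R; B_II R; B_V R; B_I R],
      (forall h : R, h < 0 ->
         orbits_in (closure (B_VI h)) = [set B_VI h; B_II R; B_I R])
      /\ [set B_IV R; B_V R; B_VI (0 : R)] `<=`
           orbits_in (closure VI_neg) `\`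
           \bigcup_(h in [set h : R | h < 0]) orbits_in (closure (B_VI h))
    & [/\ forall h : R, 0 < h ->
            orbits_in (closure (B_VII h)) = [set B_VII h; B_II R; B_I R],
          semialgebraic_dim [set mxvec c | c in VII_pos] 6
        & [set B_IV R; B_V R; B_VII (0 : R)] `<=`
            orbits_in (closure VII_pos) `\`
            \bigcup_(h in [set h : R | 0 < h]) orbits_in (closure (B_VII h))]].
Proof.
have N1 : -1 != 0 :> R by rewrite oppr_eq0 oner_neq0.
have VI_E := funext (@B_VIE R); have VII_E := funext (@B_VIIE R).
split.
- exact: orbits_in_closure_V.
- exact: orbits_in_closure_IV.
- rewrite VI_E; split=> [h h0|]; first by apply: orbits_in_closure_nf; rewrite ?lt_eqF.
  apply: orbits_in_closure_union => // h; first by move=> /ltr0_neq0.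
  by rewrite neq_lt => /orP[h0|h0]; [left | right; rewrite /= oppr_lt0].
- split; last 1 first.
  + rewrite VII_E; apply: orbits_in_closure_union => [|h /lt0r_neq0 //|h].
      exact: oner_neq0.
    by rewrite neq_lt => /orP[h0|h0]; [right; rewrite /= oppr_gt0 | left].
  + move=> h h0; rewrite VII_E; apply: orbits_in_closure_nf; last exact: oner_neq0.
    by rewrite gt_eqF.
  + exact: semialgebraic_dim_VII_pos.
Qed.
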